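(* For each $\varepsilon>0$, there exist $\delta,C>0$ such that, if $p\geq C/n$, then $G=G(n,p)$ has the following property with probability $1-o(n^{-3})$: any $(1/2+\varepsilon)$-residual subgraph $H$ of $G$ with $|H|\geq \varepsilon n$ which contains a spanning $(2,C/p)$-expander with at most $\delta pn^2$ edges is Hamiltonian.
   Context: $G(n,p)$ is the binomial random graph on $[n]$; asymptotics as $n\to\infty$. $|H|=|V(H)|$. A subgraph $H$ of $G$ is $\alpha$-residual if $d_H(v)\ge\alpha\, d_{G[V(H)]}(v)$ for all $v\in V(H)$. A graph $H$ is a $(2,k)$-expander if every $U\subset V(H)$ with $|U|\le k$ satisfies $|N(U)|\ge 2|U|$, where $N(U)$ is the set of vertices outside $U$ adjacent to a vertex of $U$ (connectivity is not required). *)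

(* Defs.v *)
From HB Require Import structures.
From mathcomp Require Import all_boot all_order all_algebra.
From mathcomp Require Import all_classical all_reals all_analysis.

Set Implicit Arguments.
Unset Strict Implicit.
Unset Printing Implicit Defensive.

Import Order.TTheory GRing.Theory Num.Theory.
Import numFieldNormedType.Exports.

Local Open Scope ring_scope.

Section Graph.
Variable T : finType.
Implicit Types (U : {set T}) (u v : T).

(* Finite simple graphs whose vertex set is a subset of T; an edge is a       *)
(* two-element set of vertices.                                               *)
Definition is_graph (VE : {set T} * {set {set T}}) : bool :=
  [forall e in VE.2, (#|e| == 2) && (e \subset VE.1)].

Record graph := Graph { graph_val : {set T} * {set {set T}};
                        graph_valP : is_graph graph_val }.

HB.instance Definition _ := [isSub for graph_val].
HB.instance Definition _ := [Finite of graph by <:].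

Implicit Types G H : graph.

Definition vertices G : {set T} := (val G).1.
Definition edges G : {set {set T}} := (val G).2.

Definition adj G : rel T := fun u v => [set u; v] \in edges G.

Definition deg G v : nat := #|[set u | adj G v u]|.

Definition subgraph H G : bool :=
  (vertices H \subset vertices G) && (edges H \subset edges G).

Lemma induced_subproof G U :
  is_graph (vertices G :&: U, [set e in edges G | e \subset U]).
Proof.
apply/forall_inP => e /=; rewrite inE => /andP[eG eU].
by have /andP[-> eV] := forall_inP (valP G) e eG; rewrite finset.subsetI eV.
Qed.

Definition induced G U : graph := Graph (induced_subproof G U).

Definition nbhd G U : {set T} :=
  [set v | (v \notin U) && [exists u in U, adj G u v]].

Definition hamiltonian G : Prop :=
  exists s : seq T,
    [/\ (2 < size s)%N, uniq s, cycle (adj G) s & s =i vertices G].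

Variable R : realType.

Definition residual (alpha : R) H G : Prop :=
  subgraph H G /\
  forall v, v \in vertices H ->
    alpha * (deg (induced G (vertices H)) v)%:R <= (deg H v)%:R.

Definition expander2 (k : R) H : Prop :=
  forall U, U \subset vertices H -> #|U|%:R <= k ->
    (2 * #|U| <= #|nbhd H U|)%N.

End Graph.

(* Only meant for graphs with vertex set all of 'I_n. *)
Definition Gnp_mass (R : realType) (n : nat) (p : R) (G : graph 'I_n) : R :=
  p ^+ #|edges G| * (1 - p) ^+ ('C(n, 2) - #|edges G|).

Definition Gnp_prob (R : realType) (n : nat) (p : R) (A : graph 'I_n -> Prop) : R :=
  \sum_(G : graph 'I_n | (vertices G == [set: 'I_n]%SET) && `[< A G >])
     Gnp_mass p G.

Lemma Gnp_prob_total (R : realType) (n : nat) (p : R) :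
  Gnp_prob p (fun _ : graph 'I_n => True) = 1.
Proof.
pose K := [set e : {set 'I_n} | #|e| == 2]%SET.
have cK : #|K| = 'C(n, 2).
  by rewrite cardsE; have := card_draws 'I_n 2; rewrite card_ord cardsE.
have sub (G : graph 'I_n) : edges G \subset K.
  by apply/fintype.subsetP => e eG; rewrite inE;
     have /andP[] := forall_inP (valP G) e eG.
have gP (E : {set {set 'I_n}}) : is_graph ([set: 'I_n]%SET, E :&: K).
  apply/forall_inP => e /=; rewrite !inE => /andP[_ ->].
  by rewrite finset.subsetT.
rewrite /Gnp_prob.
rewrite (reindex_onto (fun E => Graph (gP E)) (fun G => edges G)); last first.
  move=> G /andP[/eqP vG _]; apply: val_inj => /=.
  rewrite (finset.setIidPl (sub G)) -vG.
  by rewrite -surjective_pairing.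
transitivity (\sum_(E : {set {set 'I_n}} | E \subset K)
   (p ^+ #|E| * (1 - p) ^+ (#|K| - #|E|))).
  apply: eq_big => E.
    rewrite /vertices /edges /= eqxx /= asboolT //=.
    by apply/eqP/idP => [<-|/finset.setIidPl //]; apply: finset.subsetIr.
  rewrite /Gnp_mass /edges /= => /andP[_ /eqP->]; by rewrite cK.
transitivity ((1 - p + p) ^+ #|K|); last by rewrite subrK expr1n.
rewrite exprDn.
rewrite (partition_big (fun E : {set {set 'I_n}} => inord #|E| : 'I_(#|K|.+1)) xpredT) //=.
apply: eq_bigr => i _.
transitivity (\sum_(E : {set {set 'I_n}} | (E \subset K) && (#|E| == i))
   ((1 - p) ^+ (#|K| - i) * p ^+ i)).
  apply: eq_big => E.
    case: (boolP (E \subset K)) => //= EK.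
    by rewrite -val_eqE /= inordK // ltnS subset_leq_card.
  move=> /andP[EK /eqP <-]; rewrite inordK ?ltnS ?subset_leq_card //.
  by rewrite mulrC.
rewrite -(cards_draws K i) -sumr_const.
by apply: eq_bigl => E; rewrite !inE.
Qed.

(* Main.v *)
(** Writing [E] for the edge set of [G] and [V] for the vertex set of [H], fix
    a rule which assigns to every edge set [K] and every choice of [2 ^ O(n)]
    auxiliary data a family of vertex sets [X_b].  By a Chernoff bound for each
    [K] and a union bound over all [K] with at most [eta p n^2] edges, with
    high probability every [K] contained in [E] and every linear-size [B] with
    [|X_b| <= (1/2 + e/2) |V|] for [b] in [B] have many edges of [H] leaving
    some [b] in [B] to a vertex outside [X_b].  The point is that the rule may
    depend on [K], at no cost as long as [K] is sparse.

    Given [H], a greedy hitting set supplies a sparse part of [H] which,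
    together with the given expander and a longest path of [H] on a vertex set
    [Q], expands well up to linear size.  Posa rotations then give linearly
    many [a], each with linearly many [b] joined to [a] by a path spanning [Q].
    Applying the property to these rotations and again taking a hitting set,
    [O(n)] further edges of [H] allow one more rotation, after which each [a]
    has more than half of [V] as opposite endpoints.  Applying it once more,
    now with [X_a] the vertices that are not opposite endpoints of [a], yields
    an edge of [H] closing a cycle on [Q], and since [H] is connected, [Q = V]. *)

Require Import Defs.
From HB Require Import structures.
From mathcomp Require Import all_boot all_order all_algebra.
From mathcomp Require Import all_classical all_reals all_analysis.
From mathcomp Require Import ring lra zify.

Set Implicit Arguments.
Unset Strict Implicit.
Unset Printing Implicit Defensive.

Import Order.TTheory GRing.Theory Num.Theory.
Import numFieldNormedType.Exports.

(** * Consecutive vertices and neighbours along a path *)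

Section Consecutive.
Variable T : eqType.
Implicit Types (s t : seq T) (u v w x y z : T).

Fixpoint consec s u v : bool :=
  if s is x :: t then (x == u) && (ohead t == Some v) || consec t u v
  else false.

Lemma consec_cat s x t u v :
  consec (s ++ x :: t) u v = consec (rcons s x) u v || consec (x :: t) u v.
Proof.
elim: s => [|y s IHs] /=; first by rewrite andbF.
by rewrite IHs; case: s {IHs} => [|z s] /=; rewrite -!orbA.
Qed.

Lemma consec_rev s u v : consec (rev s) u v = consec s v u.
Proof.
elim: s => [//|x [|y s] IHs]; first by rewrite /= !andbF.
have -> : rev [:: x, y & s] = rev s ++ y :: [:: x].
  by rewrite 2!rev_cons -!cats1 -catA.
rewrite consec_cat -rev_cons IHs /= !andbF !orbF orbC.
by rewrite ![Some _ == _]/(_ == _) andbC.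
Qed.

Lemma consec_split s u v :
  consec s u v -> exists s1 s2, s = s1 ++ u :: v :: s2.
Proof.
elim: s => //= x s IHs /orP[/andP[/eqP-> ]|/IHs[s1 [s2 ->]]]; last first.
  by exists (x :: s1), s2.
by case: s {IHs} => //= y s /eqP[->]; exists [::], s.
Qed.

Lemma consec_mid s1 u v s2 : consec (s1 ++ u :: v :: s2) u v.
Proof. by rewrite consec_cat /= !eqxx orbT. Qed.

Lemma consec_predE s u v : uniq s -> consec s u v -> u = nth u s (index v s).-1.
Proof.
move=> Us /consec_split[s1 [s2 Es]].
have -> : index v s = (size s1).+1.
  move: Us; rewrite Es -cat_rcons cat_uniq => /and3P[_ /norP[vs1 _] _].
  by rewrite index_cat (negPf vs1) /= eqxx addn0 size_rcons.
by rewrite Es nth_cat ltnn subnn.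
Qed.

Lemma consec_inj s u u' v :
  uniq s -> consec s u v -> consec s u' v -> u = u'.
Proof.
move=> Us c1 c2; rewrite (consec_predE Us c1) (consec_predE Us c2).
apply: set_nth_default; case/consec_split: c1 => s1 [s2 Es].
have: v \in s by rewrite Es mem_cat !inE eqxx !orbT.
by rewrite -index_mem; case: index => //= n /ltnW.
Qed.

Definition pathnb s u v := consec s u v || consec s v u.

Lemma pathnb_rev s u v : pathnb (rev s) u v = pathnb s u v.
Proof. by rewrite /pathnb !consec_rev orbC. Qed.

Lemma pathnb_cat s x t u v :
  pathnb (s ++ x :: t) u v = pathnb (rcons s x) u v || pathnb (x :: t) u v.
Proof. by rewrite /pathnb !consec_cat orbACA. Qed.

Lemma pathnb_cons2 x y t u v : u != x -> u != y ->
  pathnb (x :: y :: t) u v = pathnb (y :: t) u v.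
Proof.
by move=> /negPf ux /negPf uy; rewrite /pathnb /= ![_ == u]eq_sym ux /=
  -[Some y == Some u]/(y == u) [y == u]eq_sym uy andbF.
Qed.

(** Reversing the tail only replaces the link between [v] and [w] by one between [v] and the old
    last vertex, so no vertex other than these three changes neighbours. *)
Lemma pathnb_rot s v w t u z :
    u != v -> u != w -> u != last w t ->
  pathnb (s ++ v :: rev (w :: t)) u z = pathnb (s ++ v :: w :: t) u z.
Proof.
move=> uv uw ul; rewrite !pathnb_cat; congr (_ || _).
rewrite pathnb_cons2 // -(pathnb_rev (w :: t)).
case/lastP: t ul => [|t y]; first by rewrite /= => _; exact: pathnb_cons2.
by rewrite last_rcons -rcons_cons rev_rcons => uy; rewrite pathnb_cons2.
Qed.

End Consecutive.

Lemma card_bigcup_le (I T : finType) (D : pred I) (F : I -> {set T}) :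
  (#|\bigcup_(i | D i) F i| <= \sum_(i | D i) #|F i|)%N.
Proof.
apply: (big_ind2 (fun (X : {set T}) m => #|X| <= m)%N) => [|X k Y l Xk Yl|//].
  by rewrite cards0.
by apply: leq_trans (leq_add Xk Yl); exact: leq_card_setU.
Qed.

(** * Paths with a prescribed vertex set and Posa rotations *)

Section SpanningPaths.
Variable T : finType.
Implicit Types (e : rel T) (s t : seq T) (Q U : {set T}) (a b u v w x y : T).

Definition spans e Q a b s :=
  [&& sorted e s, uniq s, [set x in s] == Q, ohead s == Some a &
      ohead (rev s) == Some b].

Lemma spans_mem e Q a b s x : spans e Q a b s -> (x \in s) = (x \in Q).
Proof. by case/and5P=> _ _ /eqP<- _ _; rewrite inE. Qed.

Lemma spans_head e Q a b s : spans e Q a b s -> a \in Q.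
Proof.
move=> sp; rewrite -(spans_mem _ sp); case/and5P: sp => _ _ _ + _.
by case: s => //= x s /eqP[->]; rewrite mem_head.
Qed.

Lemma spans_rev e Q a b s :
  symmetric e -> spans e Q a b s -> spans e Q b a (rev s).
Proof.
move=> se /and5P[so us /eqP sQ ha hb]; rewrite /spans rev_uniq us hb revK ha.
rewrite rev_sorted (@eq_sorted _ _ e) => [|x y]; last exact: se.
by rewrite so !andbT -sQ; apply/eqP/setP => x; rewrite !inE mem_rev.
Qed.

Lemma spans_last e Q a b s : spans e Q a b s -> b \in Q.
Proof.
move=> sp; rewrite -(spans_mem _ sp); case/and5P: sp => _ _ _ _.
rewrite -mem_rev; by case: (rev s) => //= x t /eqP[->]; rewrite mem_head.
Qed.

Lemma spans_mono e e' Q a b s :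
  subrel e e' -> spans e Q a b s -> spans e' Q a b s.
Proof.
move=> ee' /and5P[so us sQ ha hb]; apply/and5P; split=> //.
exact: sub_sorted so.
Qed.

Lemma spans_size e Q a b s : spans e Q a b s -> size s = #|Q|.
Proof.
by case/and5P=> _ us /eqP<- _ _; rewrite cardsE; exact/esym/card_uniqP.
Qed.

Lemma ohead_rev_cat2 s v w t : ohead (rev (s ++ v :: w :: t)) = Some (last w t).
Proof.
rewrite rev_cat 2!rev_cons; case/lastP: t => [|t y]; first by [].
by rewrite rev_rcons last_rcons.
Qed.

Lemma ohead_rev_rot s v w t : ohead (rev (s ++ v :: rev (w :: t))) = Some w.
Proof. by rewrite rev_cat rev_cons revK. Qed.

(** A single Posa rotation: the edge from [b] to [v] takes the place of the link from [v] to [w],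
    which frees [w] as the new end. *)
Lemma spans_rot e Q a b s v w t :
    symmetric e -> spans e Q a b (s ++ v :: w :: t) -> e b v ->
  spans e Q a w (s ++ v :: rev (w :: t)).
Proof.
move=> se /and5P[so us sQ ha hb] ebv.
have lb : last w t = b.
  by move: hb; rewrite ohead_rev_cat2 => /eqP[].
have pe : perm_eq (s ++ v :: rev (w :: t)) (s ++ v :: w :: t).
  by rewrite perm_cat2l perm_cons perm_rev.
apply/and5P; split.
- move: so; rewrite !sorted_cat_cons => /andP[-> /= /andP[_ pwt]] /=.
  (* The new tail is the reverse of [rcons (w :: t) v], so by symmetry of [e] it suffices to follow
     the old tail and then the edge from [b] to [v]. *)
  rewrite -[path e v _]/(sorted e (v :: rev (w :: t))) -[v :: _]revK rev_cons revK.
  rewrite rev_sorted (@eq_sorted _ _ e) => [|x y]; last exact: se.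
  by rewrite /= rcons_path pwt lb.
- by rewrite (perm_uniq pe).
- rewrite -(eqP sQ); apply/eqP/setP => x; rewrite !inE.
  exact: perm_mem pe x.
- by case: s ha {so us sQ hb pe}.
- by rewrite rev_cat rev_cons revK; case: s {so us sQ hb ha pe}.
Qed.

Inductive rotation e s0 : seq T -> Prop :=
| rotation_refl : rotation e s0 s0
| rotation_step s v w t : rotation e s0 (s ++ v :: w :: t) -> e (last w t) v ->
    rotation e s0 (s ++ v :: rev (w :: t)).

Lemma rotation_spans e Q a b s0 s : symmetric e -> spans e Q a b s0 ->
  rotation e s0 s -> exists c, spans e Q a c s.
Proof.
move=> se sp; elim=> [|{}s v w t _ [c spc] evl]; first by exists b.
exists w; apply: (spans_rot se spc); case/and5P: spc => _ _ _ _.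
by rewrite ohead_rev_cat2 => /eqP[<-].
Qed.

Definition endpoints e s0 : {set T} :=
  [set a | `[< exists2 s, rotation e s0 s & ohead (rev s) = Some a >]].

Lemma endpointsP e s0 a :
  reflect (exists2 s, rotation e s0 s & ohead (rev s) = Some a)
          (a \in endpoints e s0).
Proof. by rewrite inE; exact: asboolP. Qed.

(* A vertex that is neither an endpoint nor next to one keeps its two path    *)
(* neighbours, since a rotation only breaks an edge at the new endpoint.      *)
Lemma rotation_pathnb e s0 s y :
    y \notin endpoints e s0 ->
    (forall z, z \in endpoints e s0 -> ~~ pathnb s0 y z) ->
  rotation e s0 s -> pathnb s y =1 pathnb s0 y.
Proof.
move=> yA nyA; elim=> [//|{}s v w t rs IHs evl] z.
have wA : w \in endpoints e s0.
  apply/endpointsP; exists (s ++ v :: rev (w :: t)); last exact: ohead_rev_rot.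
  exact: rotation_step.
have lA : last w t \in endpoints e s0.
  apply/endpointsP; exists (s ++ v :: w :: t) => //; exact: ohead_rev_cat2.
rewrite -IHs pathnb_rot //; try by apply: contraNneq yA => ->.
(* If [y = v], then [y] would be next to the endpoint [w] on [s], hence by induction also on
   [s0]. *)
apply: contraNneq (nyA w wA) => yv.
by rewrite -IHs yv /pathnb consec_mid.
Qed.

Lemma card_consec_pred s v : uniq s -> (#|[set u | consec s u v]| <= 1)%N.
Proof.
move=> us; rewrite leqNgt; apply/card_gt1P => -[x [y []]].
by rewrite !inE => cx cy; rewrite (consec_inj us cx cy) eqxx.
Qed.

Lemma card_consec_succ s v : uniq s -> (#|[set u | consec s v u]| <= 1)%N.
Proof.
move=> us; have := @card_consec_pred (rev s) v; rewrite rev_uniq => /(_ us).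
by apply: leq_trans; apply/subset_leq_card/fintype.subsetP => u; rewrite !inE consec_rev.
Qed.

Lemma consec_last s b u : uniq s -> ohead (rev s) = Some b -> ~~ consec s b u.
Proof.
rewrite -rev_uniq -consec_rev; move: (rev s) => {}s us hs.
apply/negP => /consec_split[s1 [s2 Es]].
move: us hs; rewrite Es; case: s1 {Es} => [|x s1] /= us [xb]; move: us.
  by rewrite xb mem_head.
by rewrite xb mem_cat !inE eqxx !orbT.
Qed.

Definition edge_nbhd (E : {set {set T}}) U : {set T} :=
  [set v | (v \notin U) && [exists u in U, [set u; v] \in E]].

Definition edge_rel (E : {set {set T}}) : rel T := fun u v => [set u; v] \in E.

Lemma edge_rel_sym E : symmetric (edge_rel E).
Proof. by move=> u v; rewrite /edge_rel finset.setUC. Qed.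

(** Posa's lemma. Take for [A] all ends reachable by rotations from [s0]: every neighbour of [A]
    outside [A] lies next to a member of [A] on the original path [s0]. Each member has at most two
    such path neighbours, and [b] only one. *)
Lemma posa E Q a b s0 :
    spans (edge_rel E) Q a b s0 ->
    (forall c s, spans (edge_rel E) Q a c s -> forall y, edge_rel E c y -> y \in Q) ->
  exists A : {set T},
    [/\ forall c, c \in A -> exists s, spans (edge_rel E) Q a c s,
        (0 < #|A|)%N & (#|edge_nbhd E A| < 2 * #|A|)%N].
Proof.
move=> sp closed; have se := @edge_rel_sym E.
have [_ us0 _ _ /eqP lb] := and5P sp.
set A := endpoints (edge_rel E) s0.
have bA : b \in A by apply/endpointsP; exists s0 => //; exact: rotation_refl.
exists A; split.
- move=> c /endpointsP[s rs ls]; have [d sd] := rotation_spans se sp rs.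
  exists s; case/and5P: (sd) => _ _ _ _; rewrite ls => /eqP[cd].
  by rewrite cd.
- by apply/card_gt0P; exists b.
have sub : edge_nbhd E A \subset \bigcup_(c in A) [set z | pathnb s0 c z].
  apply/fintype.subsetP => y; rewrite inE => /andP[yA /exists_inP[c cA ecy]].
  have [s rs ls] := endpointsP _ _ _ cA.
  have [d sd] := rotation_spans se sp rs.
  have dc : d = c by case/and5P: sd => _ _ _ _; rewrite ls => /eqP[].
  rewrite dc in sd => {d dc}.
  have ys : y \in s by rewrite (spans_mem _ sd) (closed _ _ sd).
  (* If no endpoint were next to [y] on [s0], then [y] would have the same path neighbours on [s] as
     on [s0]; but rotating [s] at [y] turns the successor of [y] into an endpoint. *)
  apply: contraT => ybig.
  have nyA z : z \in A -> ~~ pathnb s0 y z.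
    move=> zA; apply: contraNN ybig => yz; apply/bigcupP; exists z => //.
    by rewrite inE /pathnb orbC.
  have [s1 [[|w t] Es]] : exists s1 t, s = s1 ++ y :: t.
    by case/splitPr: ys => s1 s2; exists s1, s2.
    move: ls; rewrite Es rev_cat /= => -[yc].
    by move: yA; rewrite yc cA.
  have wA : w \in A.
    apply/endpointsP; exists (s1 ++ y :: rev (w :: t)); last exact: ohead_rev_rot.
    apply: rotation_step; rewrite -?Es //.
    by move: ls; rewrite Es ohead_rev_cat2 => -[->].
  move: (nyA w wA); rewrite -(rotation_pathnb yA nyA rs) Es.
  by rewrite /pathnb consec_mid.
apply: (leq_ltn_trans (subset_leq_card sub)).
apply: (leq_ltn_trans (card_bigcup_le _ _)).
have nbE c :
    [set z | pathnb s0 c z] = [set z | consec s0 c z] :|: [set z | consec s0 z c].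
  by apply/setP => z; rewrite !inE.
have nb2 c : (#|[set z | pathnb s0 c z]| <= 2)%N.
  rewrite nbE (leq_trans (leq_card_setU _ _)) // -[2]/(1 + 1)%N.
  by rewrite leq_add ?card_consec_succ ?card_consec_pred.
(* [b] is last on [s0] and has no successor; this saving makes the final inequality strict. *)
have nb1 : (#|[set z | pathnb s0 b z]| <= 1)%N.
  rewrite nbE (_ : [set z | consec s0 b z] = finset.set0).
    by rewrite finset.set0U card_consec_pred.
  by apply/setP => z; rewrite !inE; apply/negbTE/consec_last.
rewrite (bigD1 b) //= (cardsD1 b A) bA mulnDr muln1 add2n ltnS.
rewrite -addn1 addnC leq_add // mulnC -sum_nat_const.
rewrite [leqRHS](eq_bigl (fun c => (c \in A) && (c != b))) ?leq_sum // => c.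
by rewrite !inE andbC.
Qed.

End SpanningPaths.

(** * Closing paths into cycles, extending them and cutting them open *)

Section CyclesAndExtensions.
Variable T : finType.
Implicit Types (e : rel T) (s : seq T) (Q : {set T}) (a b q y : T).

Lemma spans_cycle e Q a b s : spans e Q a b s -> e b a -> cycle e s.
Proof.
case/and5P=> + _ _; case: s => [//|x p] /= pxp /eqP[<-] + eba.
case/lastP: p pxp => [_ /eqP[xb]|p y].
  by rewrite /= {1}xb eba.
by rewrite -rcons_cons rev_rcons !rcons_path last_rcons => -> /eqP[->].
Qed.

Lemma spans_extend e Q a b s y :
  spans e Q a b s -> e b y -> y \notin Q -> spans e (y |: Q) a y (rcons s y).
Proof.
move=> sp eby yQ; have ys : y \notin s by rewrite (spans_mem _ sp).
case/and5P: sp => so us /eqP sQ ha hb; apply/and5P; split.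
- case: s so hb {us sQ ys ha} => //= x p; rewrite rcons_path => -> /=.
  case/lastP: p => [/eqP[->]//|p z].
  by rewrite -rcons_cons rev_rcons last_rcons => /eqP[->].
- by rewrite rcons_uniq ys.
- by rewrite -sQ; apply/eqP/setP => x; rewrite !inE mem_rcons inE.
- by case: s ha {so us sQ hb ys}.
- by rewrite rev_rcons.
Qed.

(** The edge from [b] to [a] closes a cycle, which can be cut open just after [q]. *)
Lemma spans_end_anywhere e Q a b s q :
    spans e Q a b s -> e b a -> q \in Q ->
  exists c t, spans e Q c q t.
Proof.
move=> sp eba; rewrite -(spans_mem _ sp) => qs.
have cs := spans_cycle sp eba; case/and5P: sp => so us sQ _ _.
case/splitPr: qs so us sQ cs => s1 s2 so us sQ cs.
rewrite -cat_rcons in so us sQ cs.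
pose t := s2 ++ rcons s1 q.
have tE : t = rot (size (rcons s1 q)) (rcons s1 q ++ s2) by rewrite rot_size_cat.
have [c hc] : exists c, ohead t = Some c.
  by rewrite /t; case: (s2) => [|x ?]; [case: (s1) => [|x ?] |]; eexists.
exists c, t; apply/and5P; split.
- have : cycle e t by rewrite tE rot_cycle.
  by case: (t) => //= x p; rewrite rcons_path => /andP[].
- by rewrite tE rot_uniq.
- by rewrite -(eqP sQ); apply/eqP/setP => x; rewrite !inE tE mem_rot.
- by rewrite hc.
- by rewrite /t rev_cat rev_rcons.
Qed.

End CyclesAndExtensions.

(** * Degrees as sums over edges *)

Section Degrees.
Variable T : finType.
Implicit Types (E : {set {set T}}) (B Y : {set T}) (b v : T).

Definition pairs : {set {set T}} := [set e : {set T} | #|e| == 2].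

Definition degin E b Y : nat := #|[set v in Y | [set b; v] \in E]|.

Definition joins (f : {set T}) b Y : bool := [exists v in Y, f == [set b; v]].

Lemma joins_mem f b Y : joins f b Y -> b \in f.
Proof. by case/exists_inP=> v _ /eqP->; rewrite !inE eqxx. Qed.

Lemma joinsT f b : f \in pairs -> joins f b finset.setT = (b \in f).
Proof.
rewrite inE => /cards2P[x [y [xy ->]]]; apply/idP/idP; first exact: joins_mem.
rewrite !inE => /orP[]/eqP->; apply/exists_inP.
  by exists y; rewrite ?inE.
by exists x; rewrite ?inE // finset.setUC.
Qed.

(** This makes weighted sums of degrees linear in the edge indicators, as the Chernoff bound
    needs. *)
Lemma deginE E b Y : E \subset pairs -> degin E b Y = \sum_(f in E) joins f b Y.
Proof.
move=> Ep.
have ne v : [set b; v] \in E -> b != v.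
  move=> /(fintype.subsetP Ep); rewrite inE cards2; by case: (b != v).
have -> : (\sum_(f in E) joins f b Y)%N = #|[set f in E | joins f b Y]|.
  rewrite -sum1_card big_mkcond [RHS]big_mkcond; apply: eq_bigr => f _.
  by rewrite inE; case: (f \in E) => //=; case: joins.
rewrite /degin -(@card_in_imset _ _ (fun v => [set b; v])); last first.
  move=> v w; rewrite !inE => /andP[_ /ne bv] /andP[_ /ne bw] /setP/(_ v).
  by rewrite !inE eqxx orbT [v == b]eq_sym (negPf bv) /= => /esym/eqP.
apply: eq_card => f; rewrite [RHS]inE; apply/imsetP/andP => [[v]|[fE]].
  rewrite inE => /andP[vY vE] ->; split=> //.
  by apply/exists_inP; exists v.
by case/exists_inP=> v vY /eqP fv; exists v => //; rewrite inE vY -fv.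
Qed.

Lemma degin_pairs b Y : degin pairs b Y = #|Y :\ b|.
Proof.
apply: eq_card => v; rewrite !inE cards2 andbC; congr (_ && _).
by rewrite [v == b]eq_sym; case: (b == v).
Qed.

Lemma sum_degin_le E B : E \subset pairs ->
  (\sum_(b in B) degin E b finset.setT <= 2 * #|E|)%N.
Proof.
move=> Ep; under eq_bigr => b _ do rewrite deginE //.
rewrite exchange_big /= mulnC -sum_nat_const; apply: leq_sum => f fE.
have fp := fintype.subsetP Ep f fE.
under eq_bigr => b _ do rewrite joinsT //.
move: fp; rewrite inE => /eqP<-; rewrite -sum1_card [leqRHS]big_mkcond [leqLHS]big_mkcond.
by apply: leq_sum => b _; case: (b \in B); case: (b \in f).
Qed.

Definition crossing E B (X : T -> {set T}) : {set {set T}} :=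
  [set f in E | [exists b in B, joins f b (~: X b)]].

Lemma crossing_ge E B X : E \subset pairs ->
  (\sum_(b in B) degin E b (~: X b) <= 2 * #|crossing E B X|)%N.
Proof.
move=> Ep; apply: leq_trans (@sum_degin_le (crossing E B X) B _); last first.
  by apply: fintype.subset_trans Ep; apply/fintype.subsetP => f; rewrite inE => /andP[].
apply: leq_sum => b bB; apply/subset_leq_card/fintype.subsetP => v.
rewrite !inE => /andP[vX bv]; rewrite bv /=; apply/exists_inP; exists b => //.
by apply/exists_inP; exists v => //; rewrite inE.
Qed.

End Degrees.
Local Open Scope ring_scope.

(** * Greedy hitting sets *)

Section HittingSet.
Variables (R : realType) (X I : finType) (M : {set X}) (F : I -> {set X}).
Implicit Types (D : {set I}) (T : {set X}).

Definition unhit D T : {set I} := [set i in D | [disjoint F i & T]].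

(** Averaging over [M]: the sets have total size at least [t * #|D|%:R], so some element lies in at
    least a fraction [t / K] of them. *)
Lemma hitting_element (t K : R) D :
    0 < t -> 0 < K -> #|M|%:R <= K -> (forall i, i \in D -> F i \subset M) ->
    (forall i, i \in D -> t <= #|F i|%:R) ->
  exists T, [/\ T \subset M, (#|T| <= 1)%N &
                #|unhit D T|%:R <= (1 - t / K) * #|D|%:R].
Proof.
move=> t0 K0 MK FM tF.
have [->|[i0 i0D]] := set_0Vmem D.
  exists finset.set0; rewrite finset.sub0set cards0; split=> //.
  rewrite (_ : unhit _ _ = finset.set0) ?cards0 ?mulr0 //.
  by apply/setP => i; rewrite !inE.
pose cnt x : R := \sum_(i in D) (x \in F i)%:R.
have cntE x : cnt x = #|[set i in D | x \in F i]|%:R.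
  by rewrite /cnt -natr_sum -sum1_card big_mkcond /= [in RHS]big_mkcond /=;
     congr _%:R; apply: eq_bigr => i _; rewrite inE; case: (i \in D); case: (_ \in _).
have sumE : \sum_(x in M) cnt x = \sum_(i in D) #|F i|%:R.
  rewrite exchange_big /=; apply: eq_bigr => i iD.
  rewrite -natr_sum; congr _%:R; rewrite -sum1_card [RHS]big_mkcond [LHS]big_mkcond /=.
  apply: eq_bigr => x _; case: ifP => xM; first by case: (_ \in _).
  by case: ifP => // xF; rewrite (fintype.subsetP (FM i iD) x xF) in xM.
have [x xM xc] : exists2 x, x \in M & t / K * #|D|%:R <= cnt x.
  apply: contrapT => nox.
  have lt x : x \in M -> cnt x < t / K * #|D|%:R.
    by move=> xM; rewrite ltNge; apply/negP => h; apply: nox; exists x.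
  have [x0 x0M] : exists x, x \in M.
    have /card_gt0P[x xF] : (0 < #|F i0|)%N.
      by rewrite -(ltr_nat R); apply: lt_le_trans (tF _ i0D).
    by exists x; apply: (fintype.subsetP (FM _ i0D)).
  have : \sum_(x in M) cnt x < \sum_(x in M) (t / K * #|D|%:R).
    by apply: ltr_sum => //; apply/hasP; exists x0; rewrite ?mem_index_enum.
  rewrite sumE sumr_const ltNge => /negP; apply.
  apply: (@le_trans _ _ (\sum_(i in D) t)); last exact: ler_sum.
  rewrite sumr_const -[leLHS]mulr_natr -[leRHS]mulr_natr.
  rewrite mulrAC ler_wpM2r ?ler0n // -mulrA ler_piMr ?(ltW t0) //.
  by rewrite [_^-1 * _]mulrC ler_pdivrMr ?mul1r.
exists [set x]; rewrite finset.sub1set xM cards1; split=> //.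
rewrite (_ : unhit D [set x] = D :\: [set i in D | x \in F i]); last first.
  apply/setP => i; rewrite !inE disjoint_sym disjoints1.
  by case: (i \in D); rewrite ?andbF ?andbT.
rewrite cardsDS; last by apply/fintype.subsetP => i; rewrite inE => /andP[].
rewrite natrB -?cntE ?mulrBl ?mul1r ?lerB //.
by apply/subset_leq_card/fintype.subsetP => i; rewrite inE => /andP[].
Qed.

Lemma hitting_iter (t K : R) D m :
    0 < t -> 0 < K -> #|M|%:R <= K -> (forall i, i \in D -> F i \subset M) ->
    (forall i, i \in D -> t <= #|F i|%:R) ->
  exists T, [/\ T \subset M, (#|T| <= m)%N &
                #|unhit D T|%:R <= expR (- (t / K)) ^+ m * #|D|%:R].
Proof.
move=> t0 K0 MK FM tF; elim: m => [|m [T [TM Tm Tu]]].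
  exists finset.set0; rewrite finset.sub0set cards0 expr0 mul1r ler_nat; split=> //.
  by apply/subset_leq_card/fintype.subsetP => i; rewrite inE => /andP[].
have [||T' [T'M T'1 T'u]] := @hitting_element t K (unhit D T) t0 K0 MK.
- by move=> i; rewrite inE => /andP[/FM].
- by move=> i; rewrite inE => /andP[/tF].
exists (T :|: T'); split; first by rewrite finset.subUset TM.
  by rewrite (leq_trans (leq_card_setU _ _)) // -addn1 leq_add.
rewrite (_ : unhit D (T :|: T') = unhit (unhit D T) T'); last first.
  apply/setP => i; rewrite !inE -!finset.setI_eq0 finset.setIUr finset.setU_eq0.
  by rewrite andbA.
apply: (le_trans T'u); rewrite exprS -mulrA.
apply: le_trans (ler_wpM2l (expR_ge0 _) Tu).
by rewrite ler_wpM2r ?ler0n // expR_ge1Dx.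
Qed.

(** Each greedy step multiplies the number of unhit sets by at most [expR (- (t / K))]. After more
    than [L * K / t] steps fewer than one set remains, hence none. *)
Lemma hitting_set (t K L : R) D :
    0 < t -> 0 < K -> 0 <= L -> #|M|%:R <= K ->
    (forall i, i \in D -> F i \subset M) ->
    (forall i, i \in D -> t <= #|F i|%:R) -> #|D|%:R <= expR L ->
  exists T, [/\ T \subset M, #|T|%:R <= L * K / t + 1 &
                forall i, i \in D -> exists2 x, x \in F i & x \in T].
Proof.
move=> t0 K0 L0 MK FM tF DL.
pose m := (Num.truncn (L * K / t)).+1.
have [T [TM Tm Tu]] := hitting_iter m t0 K0 MK FM tF.
have mK0 : 0 <= L * K / t by rewrite divr_ge0 ?mulr_ge0 // ltW.
exists T; split=> //.
  apply: (@le_trans _ _ m%:R); first by rewrite ler_nat.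
  by rewrite /m -addn1 natrD lerD2r truncn_le.
move=> i iD; have : unhit D T = finset.set0.
  apply/eqP; rewrite -cards_eq0 -leqn0 -ltnS -(ltr_nat R).
  apply: (le_lt_trans Tu); rewrite -expRM_natl.
  apply: (le_lt_trans (ler_wpM2l (expR_ge0 _) DL)); rewrite -expRD.
  rewrite -[ltRHS]expR0 ltr_expR.
  have : L * K / t < m%:R by apply: truncnS_gt.
  rewrite ltr_pdivrMr // => Lm; rewrite mulrN addrC subr_lt0.
  by rewrite mulrA ltr_pdivlMr.
move/setP/(_ i); rewrite !inE iD /= => /negbT/pred0Pn[x /andP[xF xT]].
by exists x.
Qed.

End HittingSet.

(** Since [1 - x <= expR (- x)], it is enough that the quadratic times [1 - x] is at least [1], that
    is, [0 <= x ^+ 2 * (1 - 2 * x)]. *)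
Lemma expR_le_quadratic (R : realType) (x : R) :
  x <= 1 / 2 -> expR x <= 1 + x + 2 * x ^+ 2.
Proof.
move=> x2; have E0 := expR_gt0 (- x).
rewrite -(ler_pM2r E0) -expRD subrr expR0.
apply: (@le_trans _ _ ((1 + x + 2 * x ^+ 2) * (1 - x))); first by nra.
by apply: ler_wpM2l; [nra | exact: expR_ge1Dx].
Qed.

(** * Independent random edges and a Chernoff bound *)

Section RandomEdges.
Variables (R : realType) (T : finType) (p : R).
Implicit Types (E K : {set {set T}}) (A : pred {set {set T}}).

Local Notation P := (pairs T).

Definition edge_weight E : R := \prod_(f in P) (if f \in E then p else 1 - p).

Definition edge_prob A : R :=
  \sum_(E : {set {set T}} | (E \subset P) && A E) edge_weight E.

Lemma edge_weight_ge0 (p01 : 0 <= p <= 1) E : 0 <= edge_weight E.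
Proof. by apply: prodr_ge0 => f _; case: ifP => _; lra. Qed.

Lemma edge_prob_le (p01 : 0 <= p <= 1) A A' :
  (forall E, E \subset P -> A E -> A' E) -> edge_prob A <= edge_prob A'.
Proof.
move=> AA'; rewrite /edge_prob big_mkcond [leRHS]big_mkcond; apply: ler_sum => E _.
have := edge_weight_ge0 p01 E; case: ifP => [/andP[EP AE]|_]; last by case: ifP.
by rewrite EP AA'.
Qed.

Lemma edge_probU (p01 : 0 <= p <= 1) A A' :
  edge_prob (fun E => A E || A' E) <= edge_prob A + edge_prob A'.
Proof.
rewrite /edge_prob !big_mkcondr -big_split; apply: ler_sum => E _ /=.
by have := edge_weight_ge0 p01 E; case: (A E); case: (A' E) => /=; lra.
Qed.

Lemma edge_prob_exists (p01 : 0 <= p <= 1) (I : finType) (D : pred I)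
    (A : I -> pred {set {set T}}) :
  edge_prob (fun E => [exists i, D i && A i E]) <= \sum_(i | D i) edge_prob (A i).
Proof.
rewrite /edge_prob [leRHS](eq_bigr (fun i =>
  \sum_(E : {set {set T}} | E \subset P) if A i E then edge_weight E else 0)); last first.
  by move=> i _; rewrite big_mkcondr.
rewrite exchange_big /= big_mkcondr; apply: ler_sum => E _.
case: ifP => [/existsP[i /andP[Di AiE]]|_]; last first.
  by apply: sumr_ge0 => i _; case: ifP => // _; exact: edge_weight_ge0.
rewrite (bigD1 i) //= AiE lerDl; apply: sumr_ge0 => j _.
by case: ifP => // _; exact: edge_weight_ge0.
Qed.

(** Expanding the product chooses presence or absence for each pair; this is how independence of the
    edges enters. *)
Lemma sum_prod_edges (g1 g0 : {set T} -> R) :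
  \sum_(E : {set {set T}} | E \subset P) \prod_(f in P) (if f \in E then g1 f else g0 f)
  = \prod_(f in P) (g1 f + g0 f).
Proof.
have := @bigA_distr R 0 1 *%R +%R {set T}
  (* Off [P] the factors [0] and [1] remove every [E] not contained in [P] and leave the other terms
     unchanged. *)
  (fun f => if f \in P then g1 f else 0) (fun f => if f \in P then g0 f else 1).
rewrite (_ : \prod_f _ = \prod_(f in P) (g1 f + g0 f)); last first.
  rewrite [RHS]big_mkcond; apply: eq_bigr => f _.
  by case: (f \in P) => //=; rewrite add0r.
move=> ->; rewrite [LHS]big_mkcond; apply: eq_bigr => E _; case: ifP => EP.
  rewrite big_mkcond; apply: eq_bigr => f _; case: (boolP (f \in P)) => //= fP.
  by case: ifP => // /(fintype.subsetP EP); rewrite (negPf fP).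
have [f fE fP] := fintype.subsetPn (negbT EP).
by rewrite (bigD1 f) //= fE (negPf fP) mul0r.
Qed.

(** An exponential Markov bound taken jointly with the event that [K] is present, so that each edge
    of [K] still contributes a factor of order [p]. *)
Lemma edge_tail (p01 : 0 <= p <= 1) (c : {set T} -> R) (la t : R) K :
    K \subset P -> (forall f, f \in P -> - 2 <= c f <= 2) -> 0 <= la <= 1 / 4 ->
  edge_prob (fun E => (K \subset E) &&
                      (p * \sum_(f in P) c f + t <= \sum_(f in E) c f))
  <= (p * expR (2 * la)) ^+ #|K| *
     expR (- (la * t) + 2 * la ^+ 2 * p * \sum_(f in P) c f ^+ 2).
Proof.
move=> KP c2 /andP[la0 la4].
(* [q] erases the absence term of every pair in [K], which restricts the expanded product to the [E]
   containing [K]. *)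
pose q f : R := (f \notin K)%:R.
have step : edge_prob (fun E => (K \subset E) &&
      (p * \sum_(f in P) c f + t <= \sum_(f in E) c f))
   <= expR (- (la * (p * \sum_(f in P) c f + t))) *
      \prod_(f in P) (p * expR (la * c f) + (1 - p) * q f).
  rewrite -sum_prod_edges; set a := expR (- _).
  rewrite [leRHS]mulr_sumr /edge_prob [leLHS]big_mkcond [leRHS]big_mkcond.
  apply: ler_sum => E _; case: (boolP (E \subset P)) => //= EP.
  have pr0 : 0 <= \prod_(f in P) (if f \in E then p * expR (la * c f) else (1 - p) * q f).
    apply: prodr_ge0 => f _; have := expR_gt0 (la * c f).
    by rewrite /q; case: ifP => _; case: (f \notin K) => /=; nra.
  case: ifP => [/andP[KE cE]|_]; last by rewrite mulr_ge0 // expR_ge0.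
  rewrite (_ : \prod_(f in P) _ = edge_weight E * expR (la * \sum_(f in E) c f)).
    rewrite mulrCA ler_peMr ?edge_weight_ge0 // /a -expRD -expR0 ler_expR; nra.
  rewrite mulr_sumr expR_sum (_ : \prod_(f in E) _ =
      \prod_(f in P) (if f \in E then expR (la * c f) else 1)).
    rewrite -big_split; apply: eq_bigr => f fP /=; case: ifP => // fE.
    rewrite /q (_ : f \notin K) ?mulr1 //; apply: contraFN fE.
    exact: (fintype.subsetP KE).
  rewrite -big_mkcondr; apply: eq_bigl => f; rewrite andbC.
  by case: (boolP (f \in E)) => //= fE; rewrite (fintype.subsetP EP).
apply: (le_trans step).
(* On [K] the bound [c f <= 2] suffices. Off [K] the quadratic bound for [expR] applies, since
   [la <= 1 / 4] keeps its argument at most [1 / 2]. *)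
have fac f : f \in P -> p * expR (la * c f) + (1 - p) * q f <=
    (if f \in K then p * expR (2 * la) else 1) *
    expR (p * (la * c f + 2 * (la * c f) ^+ 2)).
  move=> /c2/andP[cf1 cf2]; rewrite /q; case: ifP => fK /=.
    rewrite mulr0 addr0 -mulrA -expRD; apply: ler_wpM2l; first by lra.
    rewrite ler_expR.
    have : 0 <= la * (1 - p) * (2 - c f).
      by rewrite mulr_ge0 ?mulr_ge0; lra.
    have : 0 <= p * (la * c f) ^+ 2 by rewrite mulr_ge0 ?sqr_ge0; lra.
    have : 0 <= p * la by rewrite mulr_ge0; lra.
    lra.
  rewrite mulr1 mul1r.
  have x2 : la * c f <= 1 / 2.
    have : 0 <= la * (2 - c f) by rewrite mulr_ge0; lra.
    lra.
  apply: le_trans (expR_ge1Dx _).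
  have := expR_le_quadratic x2; nra.
apply: (@le_trans _ _ (expR (- (la * (p * \sum_(f in P) c f + t))) *
   \prod_(f in P) ((if f \in K then p * expR (2 * la) else 1) *
    expR (p * (la * c f + 2 * (la * c f) ^+ 2))))).
  rewrite ler_wpM2l ?expR_ge0 //; apply: ler_prod => f fP; rewrite fac // andbT.
  have := expR_gt0 (la * c f).
  by rewrite /q; case: (f \notin K) => /=; nra.
have prK : \prod_(f in P) (if f \in K then p * expR (2 * la) else 1) =
    (p * expR (2 * la)) ^+ #|K|.
  rewrite -prodr_const [RHS]big_mkcond [LHS]big_mkcond; apply: eq_bigr => f _.
  by case: (boolP (f \in K)) => [/(fintype.subsetP KP)->//|_]; case: ifP.
rewrite big_split /= prK -expR_sum mulrCA -expRD.
apply: ler_wpM2l; last rewrite ler_expR.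
  by apply: exprn_ge0; apply: mulr_ge0 (expR_ge0 _); case/andP: p01.

have -> : \sum_(f in P) p * (la * c f + 2 * (la * c f) ^+ 2) =
    p * (la * \sum_(f in P) c f + 2 * la ^+ 2 * \sum_(f in P) c f ^+ 2).
  rewrite !mulr_sumr -big_split mulr_sumr; apply: eq_bigr => f _ /=; ring.
by rewrite le_eqVlt; apply/orP; left; apply/eqP; ring.
Qed.

End RandomEdges.

(** * Discrepancy between the degrees into [X b] and into [V] *)

Section Discrepancy.
Variables (R : realType) (T : finType) (p e : R).
Implicit Types (E K : {set {set T}}) (B V : {set T}) (X : T -> {set T}).

Local Notation P := (pairs T).
Local Notation n := (#|T|%:R : R).

(** If each [b] keeps a share [1 / 2 + e] of its degree into [V], then [- disc] bounds from below
    the number of kept edges from [B] to vertices outside the sets [X b], counted from [b]. The aim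
    is therefore to make it very negative. *)
Definition disc E B V X : R :=
  \sum_(b in B) ((degin E b (X b))%:R - (1 / 2 + e) * (degin E b V)%:R).

Definition disc_weight B V X (f : {set T}) : R :=
  \sum_(b in B) ((joins f b (X b))%:R - (1 / 2 + e) * (joins f b V)%:R).

Lemma discE E B V X :
  E \subset P -> disc E B V X = \sum_(f in E) disc_weight B V X f.
Proof.
move=> EP; rewrite exchange_big /=; apply: eq_bigr => b _.
by rewrite sumrB -mulr_sumr !deginE // !natr_sum.
Qed.

Lemma disc_weight_abs (e04 : 0 < e <= 1 / 4) B V X f : f \in P ->
  `|disc_weight B V X f| <= \sum_(b in B) (joins f b finset.setT)%:R.
Proof.
move=> fP; apply: (le_trans (ler_norm_sum _ _ _)); apply: ler_sum => b _.
rewrite joinsT //; case: (boolP (b \in f)) => bf.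
  by rewrite ler_norml; case: joins; case: joins => /=; lra.
rewrite !(contraNF (@joins_mem _ _ _ _) bf) /= mulr0 subr0 normr0 //.
Qed.

Lemma sum_joins_le2 B f : f \in P -> \sum_(b in B) (joins f b finset.setT)%:R <= 2 :> R.
Proof.
move=> fP; under eq_bigr => b _ do rewrite joinsT //.
rewrite -natr_sum ler_nat; move: fP; rewrite inE => /eqP<-.
rewrite -sum1_card [leqRHS]big_mkcond [leqLHS]big_mkcond.
by apply: leq_sum => b _; case: (b \in B); case: (b \in f).
Qed.

(** One factor of each square is at most [2]; the other is at most the number of ends of the pair in
    [B], and each [b] is an end of at most [n] pairs. *)
Lemma sum_disc_weight_sq (e04 : 0 < e <= 1 / 4) B V X :
  \sum_(f in P) disc_weight B V X f ^+ 2 <= 2 * #|B|%:R * n.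
Proof.
apply: (@le_trans _ _ (\sum_(f in P) 2 * \sum_(b in B) (joins f b finset.setT)%:R)).
  apply: ler_sum => f fP; rewrite -real_normK ?num_real // expr2.
  apply: ler_pM => //; last exact: disc_weight_abs.
  exact: le_trans (disc_weight_abs e04 _ _ _ fP) (sum_joins_le2 _ fP).
rewrite -mulr_sumr -mulrA ler_wpM2l // exchange_big /=.
apply: (@le_trans _ _ (\sum_(b in B) n)); last by rewrite sumr_const mulr_natl.
apply: ler_sum => b _; rewrite -natr_sum -deginE // degin_pairs ler_nat.
by rewrite -cardsT subset_leq_card // finset.subsetT.
Qed.

(** Up to the factor [p] this is the mean. Each [b] contributes at most [- (e / 2) * #|V|%:R] plus
    an error below [1] for the pair missing at [b] itself, which [4 <= e ^+ 2 * n] absorbs. *)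
Lemma disc_pairs_le (e04 : 0 < e <= 1 / 4) B V X :
    4 <= e ^+ 2 * n -> e * n <= #|V|%:R ->
    (forall b, b \in B -> #|X b|%:R <= (1 / 2 + e / 2) * #|V|%:R) ->
  disc P B V X <= - (e ^+ 2 / 4 * #|B|%:R * n).
Proof.
move=> en eV XV; apply: (@le_trans _ _ (\sum_(b in B) - (e ^+ 2 / 4 * n))); last first.
  by rewrite sumr_const -mulr_natr; rewrite le_eqVlt; apply/orP; left; apply/eqP; ring.
apply: ler_sum => b bB; rewrite !degin_pairs.
have h1 : #|X b :\ b|%:R <= #|X b|%:R :> R.
  by rewrite ler_nat subset_leq_card // subD1set.
have h2 : #|V|%:R - 1 <= #|V :\ b|%:R :> R.
  by rewrite [#|V|](cardsD1 b) natrD; case: (_ \in _) => /=; lra.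
have := XV b bB; nra.
Qed.

Definition disc_event B V X E : bool :=
  - (e ^+ 2 / 8 * p * #|B|%:R * n) <= disc E B V X.

Lemma disc_tail (p01 : 0 <= p <= 1) (e04 : 0 < e <= 1 / 4) K B V X : K \subset P ->
    4 <= e ^+ 2 * n -> e * n <= #|V|%:R ->
    (forall b, b \in B -> #|X b|%:R <= (1 / 2 + e / 2) * #|V|%:R) ->
  edge_prob p (fun E => (K \subset E) && disc_event B V X E)
  <= (p * expR 1) ^+ #|K| * expR (- (e ^+ 4 / 1024 * p * #|B|%:R * n)).
Proof.
move=> KP en eV XV.
(* The deviation [t] is half of the bound on the mean, and [la] makes the quadratic term of the
   exponent half of [la * t]. *)
pose la := e ^+ 2 / 64; pose t := e ^+ 2 / 8 * p * #|B|%:R * n.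
have la4 : 0 <= la <= 1 / 4 by rewrite /la; apply/andP; split; nra.
have Bn : 0 <= #|B|%:R * n by rewrite mulr_ge0 ?ler0n.
have c2 f : f \in P -> -2 <= disc_weight B V X f <= 2.
  move=> fP; rewrite -ler_norml.
  exact: le_trans (disc_weight_abs e04 _ _ _ fP) (sum_joins_le2 _ fP).
have := edge_tail p01 t KP c2 la4.
set rhs := (X in _ <= X) => H; apply: (@le_trans _ _ rhs).
  apply: le_trans H; apply: edge_prob_le => // E EP /andP[-> /=].
  rewrite /disc_event -discE // -discE // => hE; apply: le_trans hE.
  have := disc_pairs_le e04 en eV XV; rewrite /t.
  move: Bn; set z := #|B|%:R * n => z0 hd.
  have : p * disc P B V X <= p * - (e ^+ 2 / 4 * #|B|%:R * n).
    by rewrite ler_wpM2l //; lra.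
  lra.
apply: ler_pM.
- by apply: exprn_ge0; apply: mulr_ge0 (expR_ge0 _); case/andP: p01.
- exact: expR_ge0.
- have [p0 _] := andP p01; apply: lerXn2r; rewrite ?nnegrE ?mulr_ge0 ?expR_ge0 //.
  by rewrite ler_wpM2l // ler_expR /la; nra.
rewrite ler_expR; have sq := sum_disc_weight_sq e04 B V X.
have : 2 * la ^+ 2 * p * \sum_(f in P) disc_weight B V X f ^+ 2 <=
       2 * la ^+ 2 * p * (2 * #|B|%:R * n).
  rewrite ler_wpM2l // mulr_ge0 ?mulr_ge0 ?sqr_ge0 //; lra.
move=> h; apply: (le_trans (lerD (lexx _) h)).
by rewrite le_eqVlt /t /la; apply/orP; left; apply/eqP; field.
Qed.

End Discrepancy.

(** * From random graphs to random edge sets *)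

Lemma card_pairs_le (R : realType) (T : finType) :
  #|pairs T|%:R <= #|T|%:R ^+ 2 / 2 :> R.
Proof.
have -> : #|pairs T| = 'C(#|T|, 2) by rewrite /pairs card_draws.
rewrite ler_pdivlMr // -natrM -natrX ler_nat -[2%N in leqLHS]/(2`!) bin_ffact.
by rewrite ffactnS ffactn1 -mulnn leq_mul2l leq_pred orbT.
Qed.

(** A graph on the full vertex set is determined by its edges, so the failures of [A] inject into
    the bad edge sets with the same weights. *)
Lemma Gnp_prob_fail (R : realType) (n : nat) (p : R) (A : graph 'I_n -> Prop)
    (bad : pred {set {set 'I_n}}) : 0 <= p <= 1 ->
    (forall G, vertices G = [set: 'I_n]%SET -> ~~ bad (edges G) -> A G) ->
  0 <= 1 - Gnp_prob p A <= edge_prob p bad.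
Proof.
move=> p01 badA.
have EP (G : graph 'I_n) : edges G \subset pairs 'I_n.
  apply/fintype.subsetP => f fG; rewrite inE.
  by have /andP[] := forall_inP (valP G) f fG.
have massE (G : graph 'I_n) : Gnp_mass p G = edge_weight p (edges G).
  rewrite /Gnp_mass /edge_weight (bigID (mem (edges G))) /=.
  rewrite (eq_bigr (fun=> p)) => [|f /andP[_ ->]//].
  rewrite [X in _ = _ * X](eq_bigr (fun=> 1 - p)) => [|f /andP[_ /negPf->]//].
  have -> : \prod_(f in pairs 'I_n | f \in edges G) p = p ^+ #|edges G|.
    rewrite -prodr_const; apply: eq_bigl => f; rewrite andbC.
    by case: (boolP (f \in edges G)) => //= /(fintype.subsetP (EP G)).
  have -> : \prod_(f in pairs 'I_n | f \notin edges G) (1 - p) =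
            (1 - p) ^+ #|pairs 'I_n :\: edges G|.
    by rewrite -prodr_const; apply: eq_bigl => f; rewrite !inE andbC.
  by rewrite cardsDS ?EP // /pairs card_draws card_ord.
have := Gnp_prob_total n p; rewrite /Gnp_prob => <-.
rewrite [X in X - _](bigID (fun G => `[< A G >])) /=.
rewrite [X in X + _ - _](eq_bigl (fun G =>
  (vertices G == [set: 'I_n]%SET) && `[< A G >])); last first.
  by move=> G; rewrite asboolT ?andbT.
rewrite addrC addKr; apply/andP; split.
  by apply: sumr_ge0 => G _; rewrite massE edge_weight_ge0.
pose D : {set graph 'I_n} := [set G | (vertices G == [set: 'I_n]%SET) && ~~ `[< A G >]].
have inj : {in D &, injective (@edges 'I_n)}.
  move=> G G'; rewrite !inE => /andP[/eqP vG _] /andP[/eqP vG' _] eG.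
  apply: val_inj; rewrite [LHS]surjective_pairing [RHS]surjective_pairing.
  by congr pair => //; rewrite -/(vertices G) -/(vertices G') vG vG'.
have -> : \sum_(G | (vertices G == [set: 'I_n]%SET) && `[< True >] && ~~ `[< A G >])
    Gnp_mass p G = \sum_(E in @edges 'I_n @: D) edge_weight p E.
  rewrite big_imset //=; apply: eq_big => G; last by rewrite massE.
  by rewrite inE asboolT ?andbT.
rewrite /edge_prob big_mkcond [leRHS]big_mkcond; apply: ler_sum => E _.
have := edge_weight_ge0 p01 E; case: imsetP => [[G]|_ w0]; last by case: ifP.
rewrite inE => /andP[/eqP vG /asboolPn nA] -> _.
rewrite EP /=; case: ifP => // /negbT nb.
by case: nA; exact: badA.
Qed.

Lemma cardsT_sets (T : finType) : #|{: {set T}}| = (2 ^ #|T|)%N.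
Proof.
rewrite -[#|T|]cardsT -card_powerset; apply: eq_card => A.
by rewrite [RHS]inE finset.subsetT.
Qed.

(** * Union bounds over auxiliary data and sparse edge sets *)

Section UnionBounds.
Variables (R : realType) (T : finType) (p e : R).
Implicit Types (E K : {set {set T}}) (B V : {set T}) (X : T -> {set T}).

Local Notation P := (pairs T).
Local Notation n := (#|T|%:R : R).

Definition admissible (s : R) B V X : bool :=
  [&& s <= #|B|%:R, e * n <= #|V|%:R &
      [forall b in B, #|X b|%:R <= (1 / 2 + e / 2) * #|V|%:R]].

Variable Aux : finType.
Variable Phi : {set {set T}} -> Aux -> T -> {set T}.

Definition bad_disc (s : R) K E : bool :=
  [exists x : Aux * {set T} * {set T},
     admissible s x.1.2 x.2 (Phi K x.1.1) &&
     disc_event p e x.1.2 x.2 (Phi K x.1.1) E].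

(** The pairs [(B, V)] account for [4 ^ #|T|]. The factor [(p * expR 1) ^+ #|K|] is retained to pay
    for the later union over [K]. *)
Lemma bad_disc_prob (s : R) K :
    0 <= p <= 1 -> 0 < e <= 1 / 4 -> K \subset P -> 4 <= e ^+ 2 * n ->
  edge_prob p (fun E => (K \subset E) && bad_disc s K E)
  <= (p * expR 1) ^+ #|K| *
     ((#|Aux| * 4 ^ #|T|)%:R * expR (- (e ^+ 4 / 1024 * p * s * n))).
Proof.
move=> p01 e04 KP en.
apply: (@le_trans _ _ (edge_prob p (fun E =>
    [exists x : Aux * {set T} * {set T}, admissible s x.1.2 x.2 (Phi K x.1.1) &&
      ((K \subset E) && disc_event p e x.1.2 x.2 (Phi K x.1.1) E)]))).
  apply: edge_prob_le => // E _ /andP[KE /existsP[x /andP[ax dx]]].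
  by apply/existsP; exists x; rewrite ax KE.
apply: (le_trans (edge_prob_exists p01 _ _)).
set c := _ ^+ _ * _.
have [p0 _] := andP p01; have [e0 _] := andP e04.
have e40 : 0 <= e ^+ 4 / 1024.
  by apply: divr_ge0 (ler0n _ _); apply: exprn_ge0; apply: ltW.
have ep0 := mulr_ge0 e40 p0.
have c0 : 0 <= (p * expR 1) ^+ #|K| by apply: exprn_ge0; apply: mulr_ge0 (expR_ge0 _).
pose d := (p * expR 1) ^+ #|K| * expR (- (e ^+ 4 / 1024 * p * s * n)).
apply: (@le_trans _ _ (\sum_(x : Aux * {set T} * {set T}) d)); last first.
  rewrite sumr_const -mulr_natl !card_prod !cardsT_sets /c /d mulrCA.
  rewrite -mulnA -expnMn lexx //.
rewrite [leLHS]big_mkcond; apply: ler_sum => -[[a B] V] _ /=.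
have d0 : 0 <= d by rewrite mulr_ge0 ?expR_ge0.
case: ifP => // /and3P[sB eV /forall_inP XV].
apply: (le_trans (disc_tail p01 e04 KP en eV XV)).
rewrite /d; apply: ler_wpM2l c0 _ _ _; rewrite ler_expR lerN2.
apply: ler_wpM2r; first exact: ler0n.
exact: ler_wpM2l sB.
Qed.

(** Each term is multiplied by [expR (z * (m - #|K|%:R))], which is at least [1]. The size
    restriction can then be dropped, and the full sum factors as a power of [1 + a * expR (- z)]. *)
Lemma sum_small_sets (m z a : R) : 0 <= a -> 0 <= z ->
  \sum_(K : {set {set T}} | (K \subset P) && (#|K|%:R <= m)) a ^+ #|K|
  <= expR (z * m + a * expR (- z) * n ^+ 2).
Proof.
move=> a0 z0.
apply: (@le_trans _ _ (expR (z * m) *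
   \sum_(K : {set {set T}} | K \subset P) (a * expR (- z)) ^+ #|K|)).
  rewrite mulr_sumr big_mkcondr; apply: ler_sum => K KP; case: ifP => Km; last first.
    by rewrite mulr_ge0 ?expR_ge0 // exprn_ge0 // mulr_ge0 ?expR_ge0.
  rewrite exprMn mulrCA ler_peMr ?exprn_ge0 // -expRM_natl -expRD.
  by rewrite -[leLHS]expR0 ler_expR mulrN subr_ge0 [_%:R * z]mulrC ler_wpM2l.
rewrite expRD ler_wpM2l ?expR_ge0 //.
rewrite (eq_bigr (fun K : {set {set T}} => \prod_(f in P)
   (if f \in K then a * expR (- z) else 1))); last first.
  move=> K KP; rewrite -prodr_const [LHS]big_mkcond [RHS]big_mkcond.
  apply: eq_bigr => f _.
  by case: (boolP (f \in K)) => [/(fintype.subsetP KP)->//|_]; case: ifP.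
rewrite sum_prod_edges prodr_const.
have y0 : 0 <= a * expR (- z) by rewrite mulr_ge0 ?expR_ge0.
apply: (@le_trans _ _ (expR (a * expR (- z)) ^+ #|P|)).
  by rewrite lerXn2r ?nnegrE ?expR_ge0 ?addr_ge0 // addrC expR_ge1Dx.
rewrite -expRM_natl ler_expR mulrC ler_wpM2l //.
have := card_pairs_le R T; have := sqr_ge0 n; lra.
Qed.

Definition bad_sparse (s m : R) E : bool :=
  [exists K : {set {set T}}, ((K \subset P) && (#|K|%:R <= m)) &&
     ((K \subset E) && bad_disc s K E)].

Lemma bad_sparse_prob (s m z : R) :
    0 <= p <= 1 -> 0 < e <= 1 / 4 -> 4 <= e ^+ 2 * n -> 0 <= z ->
  edge_prob p (bad_sparse s m)
  <= (#|Aux| * 4 ^ #|T|)%:R *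
     expR (z * m + p * expR (1 - z) * n ^+ 2 - e ^+ 4 / 1024 * p * s * n).
Proof.
move=> p01 e04 en z0; apply: (le_trans (edge_prob_exists p01 _ _)).
apply: (@le_trans _ _ (\sum_(K : {set {set T}} | (K \subset P) && (#|K|%:R <= m))
   (p * expR 1) ^+ #|K| *
     ((#|Aux| * 4 ^ #|T|)%:R * expR (- (e ^+ 4 / 1024 * p * s * n))))).
  by apply: ler_sum => K /andP[KP _]; apply: bad_disc_prob.
rewrite -mulr_suml mulrCA ler_wpM2l ?ler0n // expRD ler_wpM2r ?expR_ge0 //.
rewrite [expR (1 - z)]expRD mulrA; apply: sum_small_sets => //.
by apply: mulr_ge0 (expR_ge0 _); case/andP: p01.
Qed.

(** The mean is at most [p * n ^+ 2 / 2]; the tail bound is taken with unit weights, empty [K] and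
    [la = 1 / 4]. *)
Lemma edge_count_prob : 0 <= p <= 1 ->
  edge_prob p (fun E => p * n ^+ 2 < #|E|%:R) <= expR (- (p * n ^+ 2 / 16)).
Proof.
move=> p01.
have c2 f : f \in P -> - 2 <= (1 : R) <= 2 by move=> _; lra.
have la4 : 0 <= (1 / 4 : R) <= 1 / 4 by apply/andP; split; lra.
have := @edge_tail R T p p01 (fun=> 1) (1 / 4) (p * n ^+ 2 / 2) finset.set0
  (finset.sub0set _) c2 la4.
rewrite cards0 expr0 mul1r; set rhs := expR _ => H.
have cP := card_pairs_le R T.
have pn : p * #|P|%:R <= p * (n ^+ 2 / 2) by rewrite ler_wpM2l //; lra.
apply: (@le_trans _ _ rhs).
  apply: le_trans H; apply: edge_prob_le => // E EP.
  rewrite finset.sub0set !sumr_const /=; lra.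
rewrite /rhs ler_expR expr1n sumr_const; lra.
Qed.

End UnionBounds.

Lemma pow2_le_expR (R : realType) (k : nat) : (2 ^ k)%:R <= expR k%:R :> R.
Proof.
rewrite natrX -[k%:R]mul1r expRM_natr lerXn2r ?nnegrE ?expR_ge0 //.
exact: expR_ge1Dx.
Qed.

(** * Opposite ends of spanning paths, and longest paths *)

Section ReachableEnds.
Variable T : finType.
Implicit Types (E K : {set {set T}}) (Q U V Y : {set T}) (a b u v w : T) (s : seq T).

Lemma sorted_consec (e : rel T) s u v : sorted e s -> consec s u v -> e u v.
Proof.
move=> so /consec_split[s1 [s2 Es]]; move: so.
by rewrite Es sorted_cat_cons /= => /and3P[].
Qed.

Lemma consec_sorted (e : rel T) s :
  (forall u v, consec s u v -> e u v) -> sorted e s.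
Proof.
elim: s => [//|x [//|y s] IHs] ce /=; apply/andP; split.
  by apply: ce; rewrite /= !eqxx.
by apply: IHs => u v uv; apply: ce; rewrite /= in uv *; rewrite uv orbT.
Qed.

(** Edges are grouped by their later vertex, whose predecessor is unique when [s] has no repetition;
    this bounds their number by [#|T|]. *)
Definition path_edges s : {set {set T}} :=
  \bigcup_(v : T) [set [set u; v] | u in [set u | consec s u v]].

Lemma path_edges_consec s u v : consec s u v -> edge_rel (path_edges s) u v.
Proof.
move=> uv; apply/bigcupP; exists v => //; apply/imsetP; exists u => //.
by rewrite inE.
Qed.

Lemma path_edges_sub E s : sorted (edge_rel E) s -> path_edges s \subset E.
Proof.
move=> so; apply/bigcupsP => v _; apply/fintype.subsetP => f /imsetP[u].
by rewrite inE => uv ->; exact: sorted_consec so uv.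
Qed.

Lemma card_path_edges s : uniq s -> (#|path_edges s| <= #|T|)%N.
Proof.
move=> us; apply: (@leq_trans (\sum_(v : T) 1)); last by rewrite sum1_card.
apply: leq_trans (card_bigcup_le _ _) _; apply: leq_sum => v _.
apply: leq_trans (leq_imset_card _ _) _.
exact: card_consec_pred.
Qed.

Definition reach E Q a : {set T} :=
  [set w | `[< exists s, spans (edge_rel E) Q a w s >]].

Lemma reachP E Q a w :
  reflect (exists s, spans (edge_rel E) Q a w s) (w \in reach E Q a).
Proof. by rewrite inE; exact: asboolP. Qed.

Lemma reach_sub E Q a : reach E Q a \subset Q.
Proof. by apply/fintype.subsetP => w /reachP[s]; exact: spans_last. Qed.

(** One path is chosen once and for all from [E], [Q], [a] and [b], so that the rule [blocked] is a
    function of the sparse edge set and the auxiliary data, as the union bound requires. *)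
Definition path_to E Q a b : seq T :=
  if pselect (exists s, spans (edge_rel E) Q a b s) is left h then projT1 (cid h)
  else [::].

Lemma path_toP E Q a b :
  b \in reach E Q a -> spans (edge_rel E) Q a b (path_to E Q a b).
Proof.
by move=> /reachP h; rewrite /path_to; case: pselect => // h'; case: cid.
Qed.

Lemma path_to_uniq E Q a b : uniq (path_to E Q a b).
Proof.
by rewrite /path_to; case: pselect => // h; case: cid => s /= /and5P[].
Qed.

(* With [c = true], the vertices [v] such that rotating the chosen path from  *)
(* [a] to [b] at [v] puts the new endpoint in [Y]; with [c = false], the      *)
(* vertices of [Y] whose adjacency to [b] closes no cycle on [Q] ([a] is then *)
(* a dummy).  Both uses of the random graph go through this one rule.         *)
Definition blocked E (x : bool * T * {set T} * {set T}) b : {set T} :=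
  let: (c, a, Q, Y) := x in
  if c then [set v | [exists w in Y, consec (path_to E Q a b) v w]]
  else Y :\: reach E Q b.

Lemma card_blocked_rot E a Q Y b : (#|blocked E (true, a, Q, Y) b| <= #|Y|)%N.
Proof.
apply: (@leq_trans #|\bigcup_(w in Y) [set v | consec (path_to E Q a b) v w]|).
  apply/subset_leq_card/fintype.subsetP => v; rewrite inE => /exists_inP[w wY vw].
  by apply/bigcupP; exists w => //; rewrite inE.
apply: (@leq_trans (\sum_(w in Y) 1)); last by rewrite sum1_card.
apply: leq_trans (card_bigcup_le _ _) _.
by apply: leq_sum => w _; apply: card_consec_pred; exact: path_to_uniq.
Qed.

Lemma edge_nbhd_mono E K U : E \subset K -> edge_nbhd E U \subset edge_nbhd K U.
Proof.
move=> EK; apply/fintype.subsetP => v; rewrite !inE => /andP[-> /exists_inP[u uU uv]].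
by apply/exists_inP; exists u => //; exact: (fintype.subsetP EK).
Qed.

Lemma edge_rel_mono E K : E \subset K -> subrel (edge_rel E) (edge_rel K).
Proof. by move=> EK u v; exact: (fintype.subsetP EK). Qed.

(** Only the vertex set of a longest path is recorded, since rotations change the path but preserve
    this set. *)
Definition longest E V Q : Prop :=
  [/\ Q \subset V, exists a b s, spans (edge_rel E) Q a b s &
      forall Q' a b s, Q' \subset V -> spans (edge_rel E) Q' a b s ->
        (#|Q'| <= #|Q|)%N].

Lemma longest_exists E V : (0 < #|V|)%N -> exists Q, longest E V Q.
Proof.
case/card_gt0P=> v vV.
pose ok Q := (Q \subset V) && `[< exists a b s, spans (edge_rel E) Q a b s >].
have ok1 : ok [set v].
  rewrite /ok finset.sub1set vV; apply/asboolP; exists v, v, [:: v].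
  by rewrite /spans /= !eqxx !andbT; apply/eqP/setP => x; rewrite !inE.
case: (@arg_maxnP _ [set v] ok (fun Q => #|Q|) ok1) => Q /andP[QV /asboolP sQ] mQ.
exists Q; split=> // Q' a b s Q'V sp; apply: mQ; rewrite /ok Q'V.
by apply/asboolP; exists a, b, s.
Qed.

Lemma longest_closed E V Q a b s y :
    (forall f, f \in E -> f \subset V) -> longest E V Q ->
    spans (edge_rel E) Q a b s -> edge_rel E b y -> y \in Q.
Proof.
move=> EV [QV _ mQ] sp eby; apply: contraT => yQ.
have yV : y \in V.
  by apply: (fintype.subsetP (EV _ eby)); rewrite !inE eqxx orbT.
have := mQ _ _ _ _ _ (spans_extend sp eby yQ).
by rewrite cardsU1 yQ ltnn finset.subUset finset.sub1set yV => /(_ QV).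
Qed.

(** If [Q] missed a vertex of [V], some edge would leave [Q]; cutting the cycle open at its end in
    [Q] would give a path that this edge extends. *)
Lemma longest_cycle E V Q a b s :
    (forall f, f \in E -> f \subset V) -> longest E V Q ->
    (forall U, U \subset V -> (0 < #|U|)%N -> (2 * #|U| <= #|V|)%N ->
       (0 < #|edge_nbhd E U|)%N) ->
    spans (edge_rel E) Q a b s -> edge_rel E b a -> Q = V.
Proof.
move=> EV lQ conn sp eba; have [QV _ _] := lQ; apply/eqP.
rewrite finset.eqEsubset QV /=; apply/fintype.subsetP => x xV; apply: contraT => xQ.
have nbV U v : v \in edge_nbhd E U -> v \in V.
  rewrite inE => /andP[_ /exists_inP[u _ uv]].
  by apply: (fintype.subsetP (EV _ uv)); rewrite !inE eqxx orbT.
have [q [z [qQ zQ qz]]] : exists q z, [/\ q \in Q, z \notin Q & edge_rel E q z].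
  (* Connectivity is applied to whichever of [Q] and [V :\: Q] has at most half of the vertices. *)
  have [Qh|Qh] := leqP (2 * #|Q|) #|V|.
    have Q0 : (0 < #|Q|)%N by apply/card_gt0P; exists a; exact: spans_head sp.
    have /card_gt0P[z] := conn Q QV Q0 Qh.
    by rewrite inE => /andP[zQ /exists_inP[q qQ qz]]; exists q, z.
  have D0 : (0 < #|V :\: Q|)%N by apply/card_gt0P; exists x; rewrite inE xQ.
  have Dh : (2 * #|V :\: Q| <= #|V|)%N.
    rewrite cardsDS // mulnBr leq_subLR mul2n -addnn leq_add2r.
    by rewrite (leq_trans (ltnW Qh)) // mul2n.
  have /card_gt0P[q qN] := conn _ (subsetDl _ _) D0 Dh.
  have qV := nbV _ _ qN; move: qN; rewrite !inE qV andbT negbK.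
  case/andP=> qQ /exists_inP[z]; rewrite inE => /andP[zQ zV] zq.
  by exists q, z; split=> //; rewrite edge_rel_sym.
have [c [t spt]] := spans_end_anywhere sp eba qQ.
by rewrite (longest_closed EV lQ spt qz) in zQ.
Qed.

End ReachableEnds.

(** * Hamiltonicity from the pseudorandom properties *)

Section Deterministic.
Variables (R : realType) (T : finType).
Implicit Types (E EG EH ES K : {set {set T}}) (B U V Q : {set T}) (a b v w : T).

Local Notation n := (#|T|%:R : R).

Definition resilient (e : R) EG EH V : Prop :=
  [/\ EG \subset pairs T, EH \subset EG, forall f, f \in EH -> f \subset V &
      forall v, v \in V ->
        (1 / 2 + e) * (degin EG v V)%:R <= (degin EH v finset.setT)%:R].

(** At each [b], the edges of [EH] into [X b] are among those of [EG]; the rest of the degree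
    guaranteed by resilience leaves [X b]. An edge may be counted from both ends, hence [16] in
    place of [8]. *)
Lemma crossing_of_disc (p e : R) EG EH B V X :
    resilient e EG EH V -> B \subset V -> ~~ disc_event p e B V X EG ->
  e ^+ 2 / 16 * p * #|B|%:R * n <= #|crossing EH B X|%:R.
Proof.
move=> [EP HG HV res] BV; rewrite -ltNge => ltd.
have cr := crossing_ge B X (fintype.subset_trans HG EP).
have key : - disc e EG B V X <= \sum_(b in B) (degin EH b (~: X b))%:R.
  rewrite -sumrN; apply: ler_sum => b bB.
  have h1 := res b (fintype.subsetP BV b bB).
  have h2 : (degin EH b (X b) <= degin EG b (X b))%N.
    apply/subset_leq_card/fintype.subsetP => v; rewrite !inE => /andP[-> vE].
    exact: (fintype.subsetP HG).
  have h3 : degin EH b finset.setT = (degin EH b (X b) + degin EH b (~: X b))%N.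
    rewrite /degin -(cardsID (X b)); congr (_ + _)%N; apply: eq_card => v;
      rewrite !inE /=; by [rewrite andbC | rewrite andbC].
  move: h2 h1; rewrite h3 -(ler_nat R) natrD => h2 h1; lra.
move: cr; rewrite -(ler_nat R) natr_sum natrM => cr.
move: key cr ltd; set d := disc _ _ _ _ _; set S := \sum_(b in B) _.
move=> key cr ltd; lra.
Qed.

(** For every large [U] and every small target set, many edges of [EH] lead from [U] out of the
    target. There are at most [expR (2 * n)] such demands, so a sparse hitting set meets them
    all. *)
Lemma sparse_connector (p e C : R) EG EH V :
    0 < p -> 0 < e <= 1 / 4 -> 0 < C -> 0 < n ->
    resilient e EG EH V -> e * n <= #|V|%:R -> #|EG|%:R <= p * n ^+ 2 ->
    ~~ bad_disc p e (fun (_ : {set {set T}}) (Y : {set T}) (_ : T) => Y)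
         (C / p) finset.set0 EG ->
  exists T1 : {set {set T}}, [/\ T1 \subset EH,
    #|T1|%:R <= 32 * p * n ^+ 2 / (e ^+ 2 * C) + 1 &
    forall U, U \subset V -> C / p <= #|U|%:R ->
      (1 / 2 + e / 2) * #|V|%:R < #|U :|: edge_nbhd T1 U|%:R].
Proof.
move=> p0 /andP[e0 e4] C0 n0 res eV cG good.
have [EP HG _ _] := res.
pose D : {set {set T} * {set T}} :=
  [set x : {set T} * {set T} | [&& x.1 \subset V,
   C / p <= #|x.1|%:R & #|x.2|%:R <= (1 / 2 + e / 2) * #|V|%:R]].
pose F (x : {set T} * {set T}) := crossing EH x.1 (fun=> x.2).
have t0 : 0 < e ^+ 2 * C * n / 16.
  by apply: divr_gt0 => //; apply: mulr_gt0 => //; apply: mulr_gt0 => //; exact: exprn_gt0.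
have K0 : 0 < p * n ^+ 2 by apply: mulr_gt0 => //; exact: exprn_gt0.
have L0 : 0 <= 2 * n by rewrite mulr_ge0 ?ler0n.
have FM x : x \in D -> F x \subset EH.
  by move=> _; apply/fintype.subsetP => f; rewrite inE => /andP[].
have HK : #|EH|%:R <= p * n ^+ 2.
  by apply: le_trans cG; rewrite ler_nat subset_leq_card.
have tF x : x \in D -> e ^+ 2 * C * n / 16 <= #|F x|%:R.
  rewrite inE => /and3P[xV Cx xX].
  apply: le_trans (crossing_of_disc (p := p) res xV _).
    have : C <= p * #|x.1|%:R by rewrite mulrC -ler_pdivrMr.
    move=> /(ler_wpM2l (sqr_ge0 e)) /(ler_wpM2r (ltW n0)); lra.
  apply: contraNN good => de; apply/existsP; exists (x.2, x.1, V) => /=.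
  by rewrite de andbT /admissible Cx eV; apply/forall_inP.
have DL : #|D|%:R <= expR (2 * n).
  apply: (@le_trans _ _ (2 ^ (2 * #|T|))%:R); last first.
    by apply: le_trans (pow2_le_expR _ _) _; rewrite natrM.
  rewrite ler_nat (leq_trans (max_card _)) // card_prod !cardsT_sets.
  by rewrite -expnD mul2n addnn.
have [T1 [T1H T1c T1hit]] := hitting_set t0 K0 L0 HK FM tF DL.
exists T1; split=> //.
  apply: (le_trans T1c); rewrite lerD2r le_eqVlt; apply/orP; left; apply/eqP.
  by field; rewrite !gt_eqF.
move=> U UV CU; rewrite ltNge; apply/negP => Usmall.
(* The target is [U] with its own [T1]-neighbourhood, which no edge of [T1] from [U] can leave. *)
have [f] : exists2 f, f \in F (U, U :|: edge_nbhd T1 U) & f \in T1.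
  by apply: T1hit; rewrite inE UV CU.
rewrite inE => /andP[_ /exists_inP[b bU /exists_inP[v vX /eqP->]]] bv.
move: vX; rewrite !inE negb_or => /andP[vU /negP[]]; rewrite vU /=.
by apply/exists_inP; exists b.
Qed.

(** Up to size [C / p] the given expander acts. A larger [U] covers, with its neighbourhood, more
    than half of [V], which forces doubling below [#|V| / 8] and a neighbour up to [#|V| / 2]. *)
Lemma connector_expansion (p e C : R) ES (T1 : {set {set T}}) K V :
    0 < e -> ES \subset K -> T1 \subset K ->
    (forall U, U \subset V -> #|U|%:R <= C / p ->
      (2 * #|U| <= #|edge_nbhd ES U|)%N) ->
    (forall U, U \subset V -> C / p <= #|U|%:R ->
      (1 / 2 + e / 2) * #|V|%:R < #|U :|: edge_nbhd T1 U|%:R) ->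
  (forall U, U \subset V -> (8 * #|U| <= #|V|)%N ->
     (2 * #|U| <= #|edge_nbhd K U|)%N) /\
  (forall U, U \subset V -> (0 < #|U|)%N -> (2 * #|U| <= #|V|)%N ->
     (0 < #|edge_nbhd K U|)%N).
Proof.
move=> e0 SK TK hS hT.
have big U : U \subset V -> C / p <= #|U|%:R -> (#|V| < 2 * (#|U| + #|edge_nbhd K U|))%N.
  move=> UV /(hT U UV) h; rewrite -(ltr_nat R) natrM natrD.
  have h1 : #|U :|: edge_nbhd T1 U|%:R <= #|U|%:R + #|edge_nbhd T1 U|%:R :> R.
    by rewrite -natrD ler_nat leq_card_setU.
  have h2 : #|edge_nbhd T1 U|%:R <= #|edge_nbhd K U|%:R :> R.
    by rewrite ler_nat subset_leq_card // edge_nbhd_mono.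
  have h3 : 0 <= e * #|V|%:R by rewrite mulr_ge0 ?ler0n // ltW.
  lra.
have small U : U \subset V -> #|U|%:R <= C / p -> (2 * #|U| <= #|edge_nbhd K U|)%N.
  move=> UV /(hS U UV) h; apply: (leq_trans h).
  by rewrite subset_leq_card // edge_nbhd_mono.
split=> U UV.
  move=> U8; have [/(small U UV)//|/ltW/(big U UV)] := leP (#|U|%:R) (C / p).
  move: (#|U|) (#|V|) (#|edge_nbhd K U|) U8 => x y z; lia.
move=> U0 U2; have [/(small U UV)|/ltW/(big U UV)] := leP (#|U|%:R) (C / p).
  by apply: leq_trans; rewrite muln_gt0.
move: (#|U|) (#|V|) (#|edge_nbhd K U|) U2 => x y z; lia.
Qed.

(** The end set from Posa's lemma in [K] fails to double, so it is too large for the expansion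
    hypothesis. Maximality of [Q] in the larger [EH] keeps the [K]-neighbours of ends inside [Q]. *)
Lemma many_ends K EH V Q a b s0 :
    K \subset EH -> (forall f, f \in EH -> f \subset V) -> longest EH V Q ->
    (forall U, U \subset V -> (8 * #|U| <= #|V|)%N ->
       (2 * #|U| <= #|edge_nbhd K U|)%N) ->
    spans (edge_rel K) Q a b s0 -> (#|V| < 8 * #|reach K Q a|)%N.
Proof.
move=> KH HV lQ exp sp.
have closed c s : spans (edge_rel K) Q a c s -> forall y, edge_rel K c y -> y \in Q.
  move=> spc y cy; apply: (longest_closed HV lQ (spans_mono (edge_rel_mono KH) spc)).
  exact: edge_rel_mono cy.
have [A [Areach A0 AN]] := posa sp closed.
have Asub : A \subset reach K Q a.
  by apply/fintype.subsetP => c cA; apply/reachP; exact: Areach.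
have AV : A \subset V.
  have [QV _ _] := lQ.
  exact: fintype.subset_trans Asub (fintype.subset_trans (reach_sub _ _ _) QV).
rewrite ltnNge; apply/negP => small.
have A8 : (8 * #|A| <= #|V|)%N.
  by apply: leq_trans small; rewrite leq_mul2l subset_leq_card.
by have := exp A AV A8; rewrite leqNgt AN.
Qed.

(** Rotating the chosen path with the edge of [T2] makes the successor of [v] an end, hence a member
    of [Y]. *)
Lemma rotation_reach K1 (T2 : {set {set T}}) EH V Q a b v Y :
    K1 \subset EH -> T2 \subset EH -> EH \subset pairs T ->
    (forall f, f \in EH -> f \subset V) -> longest EH V Q ->
    Y = reach (K1 :|: T2) Q a ->
    b \in reach K1 Q a -> [set b; v] \in T2 -> v \in blocked K1 (true, a, Q, Y) b.
Proof.
move=> K1H T2H HP HV lQ YE bR bv; have sp := path_toP bR.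
have se := @edge_rel_sym T.
have spH := spans_mono (edge_rel_mono K1H) sp.
have vQ : v \in Q by apply: (longest_closed HV lQ spH); exact: (fintype.subsetP T2H).
have vb : b != v.
  have := fintype.subsetP HP _ (fintype.subsetP T2H _ bv).
  by rewrite inE cards2; case: (b != v).
rewrite inE; set s := path_to K1 Q a b in sp *.
have [s1 [[|w t] Es]] : exists s1 t, s = s1 ++ v :: t.
- have : v \in s by rewrite (spans_mem _ sp).
  by case/splitPr => s1 s2; exists s1, s2.
- case/and5P: sp => _ _ _ _; rewrite Es rev_cat /= => /eqP[vb'].
  by rewrite vb' eqxx in vb.
apply/exists_inP; exists w; last by rewrite Es consec_mid.
rewrite YE; apply/reachP; exists (s1 ++ v :: rev (w :: t)).
apply: (@spans_rot _ _ _ _ b) => //; last by rewrite /edge_rel inE bv orbT.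
by rewrite -Es; apply: spans_mono sp; apply: edge_rel_mono; exact: finset.subsetUl.
Qed.

(** The summands bounded by [m] account for the expander, the connector [T1], the edges of one
    longest path and the rotating edges [T2], so that [bad_sparse] covers both [K1] and [K2]. *)
Lemma resilient_hamiltonian (p e C m : R) EG EH ES V :
    0 < p -> 0 < e <= 1 / 4 -> 0 < C -> 4 <= e ^+ 2 * n ->
    resilient e EG EH V -> e * n <= #|V|%:R -> #|EG|%:R <= p * n ^+ 2 ->
    ~~ bad_disc p e (fun (_ : {set {set T}}) (Y : {set T}) (_ : T) => Y)
         (C / p) finset.set0 EG ->
    ~~ bad_sparse p e (@blocked T) (e / 8 * n) m EG ->
    ES \subset EH ->
    (forall U, U \subset V -> #|U|%:R <= C / p ->
      (2 * #|U| <= #|edge_nbhd ES U|)%N) ->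
    #|ES|%:R + (32 * p * n ^+ 2 / (e ^+ 2 * C) + 1) + n + (256 * n / e ^+ 3 + 1) <= m ->
  exists s : seq T, [/\ (2 < size s)%N, uniq s, cycle (edge_rel EH) s & s =i V].
Proof.
move=> p0 e04 C0 en res eV cG good1 good2 SH expS cnt.
have [e0 e4] := andP e04.
have [EP HG HV _] := res; have HP := fintype.subset_trans HG EP.
have n0 : 0 < n by rewrite -(pmulr_rgt0 _ (exprn_gt0 2 e0)); apply: lt_le_trans en.
have [T1 [T1H T1c T1hit]] := sparse_connector p0 e04 C0 n0 res eV cG good1.
have V16 : (16 <= #|V|)%N.
  rewrite -(ler_nat R); apply: le_trans eV.
  have : 16 * e ^+ 2 <= 4 * e by nra.
  nra.
have [|Q lQ] := @longest_exists _ EH V; first exact: leq_trans V16.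
have [QV [a0 [b0 [s0 sp0]]] _] := lQ.
have [so0 us0 _ _ _] := and5P sp0.
(* Including the edges of [s0] lets rotations start inside the sparse set [K1]. *)
pose K1 := ES :|: T1 :|: path_edges s0.
have K1H : K1 \subset EH by rewrite !finset.subUset SH T1H path_edges_sub.
have SK1 : ES \subset K1 by rewrite /K1 -finset.setUA finset.subsetUl.
have T1K1 : T1 \subset K1 by rewrite /K1 finset.setUAC finset.subsetUr.
have [exp8 _] := connector_expansion e0 SK1 T1K1 expS T1hit.
have [_ conn] := connector_expansion e0 SH T1H expS T1hit.
have sp1 : spans (edge_rel K1) Q a0 b0 s0.
  case/and5P: sp0 => _ u1 u2 u3 u4; apply/and5P; split=> //.
  apply: consec_sorted => u v uv; rewrite /edge_rel inE.
  by rewrite [X in _ || X](path_edges_consec uv) orbT.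
set A := reach K1 Q a0.
have A8 : (#|V| < 8 * #|A|)%N := many_ends K1H HV lQ exp8 sp1.
have B8 a : a \in A -> (#|V| < 8 * #|reach K1 Q a|)%N.
  move=> /reachP[s sp]; apply: (many_ends K1H HV lQ exp8).
  exact: (spans_rev (@edge_rel_sym _ _) sp).
have large B : (#|V| < 8 * #|B|)%N -> e / 8 * n <= #|B|%:R.
  by rewrite -(ltr_nat R) natrM => h; lra.
have reachV K a : reach K Q a \subset V.
  exact: fintype.subset_trans (reach_sub _ _ _) QV.
have K1P := fintype.subset_trans K1H HP.
have K1m : #|K1|%:R <= #|ES|%:R + (32 * p * n ^+ 2 / (e ^+ 2 * C) + 1) + n.
  apply: (@le_trans _ _ (#|ES| + #|T1| + #|T|)%:R).
    rewrite ler_nat; apply: leq_trans (leq_card_setU _ _) _.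
    by apply: leq_add; rewrite ?card_path_edges // leq_card_setU.
  by rewrite !natrD lerD2r lerD2l.
have t0 : 0 < e ^+ 3 * p * n ^+ 2 / 128.
  by apply: divr_gt0 => //; apply: mulr_gt0; [apply: mulr_gt0 => //|]; exact: exprn_gt0.
have K0 : 0 < p * n ^+ 2 by apply: mulr_gt0 => //; exact: exprn_gt0.
have L0 : 0 <= 2 * n by rewrite mulr_ge0 ?ler0n.
have T2b0 : 0 <= 256 * n / e ^+ 3 + 1.
  apply: addr_ge0 ler01; apply: divr_ge0; last exact/ltW/exprn_gt0.
  exact: mulr_ge0 (ler0n _ _) (ltW n0).
(* Used with [K1] to find rotating edges and with [K2] to find the closing edge. The constant is
   [e ^+ 2 / 16] times the density [e / 8] of [B]. *)
have cross K B Y : K \subset EH -> #|K|%:R <= m -> B \subset V ->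
    (#|V| < 8 * #|B|)%N ->
    (forall b, b \in B -> #|blocked K Y b|%:R <= (1 / 2 + e / 2) * #|V|%:R) ->
    e ^+ 3 * p * n ^+ 2 / 128 <= #|crossing EH B (blocked K Y)|%:R.
  move=> KH Km BV /large Blarge Xs.
  apply: le_trans (crossing_of_disc (p := p) res BV _).
    have h : 0 <= e ^+ 2 / 16 * p * n.
      apply: mulr_ge0 (ltW n0); apply: mulr_ge0 (ltW p0).
      exact: divr_ge0 (sqr_ge0 e) (ler0n _ _).
    have := ler_wpM2l h Blarge; lra.
  apply: contraNN good2 => de; apply/existsP; exists K.
  rewrite (fintype.subset_trans KH HP) Km (fintype.subset_trans KH HG) /=.
  apply/existsP; exists (Y, B, V) => /=.
  by rewrite de andbT /admissible Blarge eV; apply/forall_inP.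
pose D : {set T * {set T}} :=
  [set x : T * {set T} | (x.1 \in A) && (#|x.2|%:R <= (1 / 2 + e / 2) * #|V|%:R)].
pose F (x : T * {set T}) :=
  crossing EH (reach K1 Q x.1) (blocked K1 (true, x.1, Q, x.2)).
have FM x : x \in D -> F x \subset EH.
  by move=> _; apply/fintype.subsetP => f; rewrite inE => /andP[].
have HK : #|EH|%:R <= p * n ^+ 2.
  by apply: le_trans cG; rewrite ler_nat subset_leq_card.
have K1m' : #|K1|%:R <= m.
  by apply: le_trans cnt; apply: (le_trans K1m); rewrite lerDl.
have tF x : x \in D -> e ^+ 3 * p * n ^+ 2 / 128 <= #|F x|%:R.
  rewrite inE => /andP[xA xY]; apply: cross => //; first exact: B8.
  move=> b _; apply: le_trans xY; rewrite ler_nat; exact: card_blocked_rot.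
have DL : #|D|%:R <= expR (2 * n).
  apply: (@le_trans _ _ (2 ^ (2 * #|T|))%:R); last first.
    by apply: le_trans (pow2_le_expR _ _) _; rewrite natrM.
  rewrite ler_nat (leq_trans (max_card _)) // card_prod !cardsT_sets.
  by rewrite mul2n -addnn expnD leq_mul2r ltnW ?orbT // ltn_expl.
have [T2 [T2H T2c T2hit]] := hitting_set t0 K0 L0 HK FM tF DL.
pose K2 := K1 :|: T2.
have K2H : K2 \subset EH by rewrite finset.subUset K1H.
have K2m : #|K2|%:R <= m.
  apply: le_trans cnt.
  apply: (@le_trans _ _ (#|K1| + #|T2|)%:R); first by rewrite ler_nat leq_card_setU.
  rewrite natrD; apply: lerD => //; apply: (le_trans T2c).
  rewrite lerD2r le_eqVlt; apply/orP; left; apply/eqP.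
  by field; rewrite !gt_eqF.
(* Otherwise [reach K2 Q a] is itself a demand in [D], and the edge of [T2] meeting it contradicts
   [rotation_reach]. *)
have R2 a : a \in A -> (1 / 2 + e / 2) * #|V|%:R < #|reach K2 Q a|%:R.
  move=> aA; rewrite ltNge; apply/negP => small.
  have [f] : exists2 f, f \in F (a, reach K2 Q a) & f \in T2.
    by apply: T2hit; rewrite inE aA.
  rewrite inE => /andP[_ /exists_inP[b bR /exists_inP[v + /eqP->]]] bv.
  rewrite inE => /negP; apply; exact: (rotation_reach K1H T2H HP HV lQ).
(* By [R2] the blocked sets [V :\: reach K2 Q b] have less than half of [V], so some edge of [EH]
   joins an [a] in [A] to one of its opposite ends. *)
have [a [w [aA wR aw]]] : exists a w, [/\ a \in A, w \in reach K2 Q a & edge_rel EH a w].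
  have : 0 < #|crossing EH A (blocked K2 (false, a0, Q, V))|%:R :> R.
    apply: lt_le_trans t0 _; apply: cross => //; first exact: reachV.
    move=> b bA; rewrite /blocked cardsDS ?reachV // natrB ?subset_leq_card ?reachV //.
    have := R2 b bA; have : 0 <= e * #|V|%:R by rewrite mulr_ge0 ?ler0n // ltW.
    lra.
  rewrite ltr0n => /card_gt0P[f]; rewrite inE => /andP[fH].
  case/exists_inP=> a aA /exists_inP[w wX /eqP fE]; rewrite fE in fH.
  have wV : w \in V.
    by apply: (fintype.subsetP (HV _ fH)); rewrite !inE eqxx orbT.
  exists a, w; split=> //; move: wX.
  by rewrite finset.in_setC finset.in_setD wV andbT negbK.
have /reachP[s /(spans_mono (edge_rel_mono K2H)) sp] := wR.
have wa : edge_rel EH w a by rewrite edge_rel_sym.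
have QE : Q = V := longest_cycle HV lQ conn sp wa.
exists s; split.
- by rewrite (spans_size sp) QE (leq_trans _ V16).
- by case/and5P: sp.
- exact: spans_cycle sp wa.
- by move=> x; rewrite (spans_mem _ sp) QE.
Qed.

End Deterministic.

(** * Total failure probability *)

Section FailureProbability.
Variables (R : realType) (T : finType).

Local Notation n := (#|T|%:R : R).

Definition bad_edges (p e C m : R) (E : {set {set T}}) : bool :=
  [|| bad_disc p e (fun (_ : {set {set T}}) (Y : {set T}) (_ : T) => Y)
        (C / p) finset.set0 E,
      bad_sparse p e (@blocked T) (e / 8 * n) m E | p * n ^+ 2 < #|E|%:R].

(** Each of three failures has probability at most [expR (- n)]. The first union has
    [2 ^ (3 * #|T|)] terms against [expR (- (4 * n))]. In the second, the last hypothesis makes the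
    union over [K] cost at most half of the gain; the other half, at least [7 * n] in the exponent,
    beats [2 ^ (6 * #|T|)]. *)
Lemma bad_edges_prob (p e C eta z : R) :
    0 < p <= 1 -> 0 < e <= 1 / 4 -> 4 <= e ^+ 2 * n -> 0 <= z -> C <= p * n ->
    4 <= e ^+ 4 / 1024 * C -> 16 <= C ->
    14 <= e ^+ 4 / 1024 * (e / 8) * C ->
    z * eta + expR (1 - z) <= e ^+ 4 / 1024 * (e / 8) / 2 ->
  edge_prob p (bad_edges p e C (eta * p * n ^+ 2)) <= 3 * expR (- n).
Proof.
move=> /andP[p0 p1] e04 en z0 Cpn C1 C2 C3 zeta.
have p01 : 0 <= p <= 1 by rewrite p1 ltW.
have n0 : 0 <= n := ler0n _ _.
move: C1 C3 zeta; set th := e ^+ 4 / 1024 => C1 C3 zeta.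
have pow k : (2 ^ (k * #|T|))%:R <= expR (k%:R * n) :> R.
  by apply: le_trans (pow2_le_expR _ _) _; rewrite natrM.
have h1 : edge_prob p (bad_disc p e (fun (_ : {set {set T}}) (Y : {set T}) (_ : T) => Y)
        (C / p) finset.set0) <= expR (- n).
  have := bad_disc_prob (T := T) (fun (_ : {set {set T}}) (Y : {set T}) (_ : T) => Y) (C / p)
    p01 e04 (finset.sub0set _) en.
  rewrite cards0 expr0 mul1r => H.
  apply: le_trans (le_trans H _).
    by apply: edge_prob_le => // E _ ->; rewrite finset.sub0set.
  rewrite cardsT_sets -[4%N]/(2 ^ 2)%N -expnM -expnD -mulSn -[_ * p * _]mulrA.
  rewrite [p * _]mulrC divfK ?gt_eqF // -/th.
  apply: (le_trans (ler_wpM2r (expR_ge0 _) (pow 3))); rewrite -expRD ler_expR.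
  have := ler_wpM2r n0 C1; lra.
have h2 : edge_prob p (bad_sparse p e (@blocked T) (e / 8 * n) (eta * p * n ^+ 2))
    <= expR (- n).
  apply: (le_trans (bad_sparse_prob _ _ _ p01 e04 en z0)); rewrite -/th.
  have cA : (#|{: bool * T * {set T} * {set T}}| * 4 ^ #|T| <= 2 ^ (6 * #|T|))%N.
    rewrite !card_prod card_bool !cardsT_sets -[4%N]/(2 ^ 2)%N -expnM.
    have T0 : (0 < #|T|)%N.
      by rewrite lt0n; apply: contraTneq en => ->; rewrite mulr0 -ltNge.
    have -> : (6 * #|T| = #|T| + #|T| + #|T| + #|T| + 2 * #|T|)%N.
      by rewrite !mulSn mul0n !addnA addn0.
    rewrite !expnD !leq_mul // ?(ltnW (ltn_expl _ _)) //.
    by rewrite -{1}[2%N]expn1 leq_exp2l.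
  apply: (@le_trans _ _ (expR (6 * n) * expR (- (7 * n)))); last first.
    by rewrite -expRD ler_expR; lra.
  apply: ler_pM; rewrite ?ler0n ?expR_ge0 //.
    by apply: le_trans (pow 6%N); rewrite ler_nat.
  rewrite ler_expR.
  have pn0 : 0 <= p * n ^+ 2 by apply: mulr_ge0 (ltW p0) (exprn_ge0 _ n0).
  have k1 := ler_wpM2r pn0 zeta.
  have th0 : 0 <= th * (e / 8).
    have [e0 _] := andP e04; apply: mulr_ge0; last by lra.
    by apply: divr_ge0 (ler0n _ _); apply: exprn_ge0; exact: ltW.
  have k2 := ler_wpM2l th0 (ler_wpM2r n0 Cpn).
  have k3 := ler_wpM2r n0 C3.
  move: (expR (1 - z)) th k1 k2 k3 {C1 C3 zeta th0} => y th k1 k2 k3.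
  lra.
have h3 : edge_prob p (fun E : {set {set T}} => p * n ^+ 2 < #|E|%:R) <= expR (- n).
  apply: (le_trans (edge_count_prob T p01)); rewrite ler_expR.
  have := ler_wpM2r n0 Cpn; have := ler_wpM2r n0 C2; lra.
apply: (le_trans (edge_probU p01 _ _)).
have := edge_probU p01 (bad_sparse p e (@blocked T) (e / 8 * n) (eta * p * n ^+ 2))
  (fun E : {set {set T}} => p * n ^+ 2 < #|E|%:R).
move: h1 h2 h3; set x1 := edge_prob p _; set x2 := edge_prob p _.
set x3 := edge_prob p _; set x4 := edge_prob p _ => h1 h2 h3 h4; lra.
Qed.

End FailureProbability.

(** * Choice of constants and conclusion *)

Lemma residual_resilient (R : realType) (T : finType) (eps e : R) (G H : graph T) :
  e <= eps -> residual (1 / 2 + eps) H G ->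
  resilient e (edges G) (edges H) (vertices H).
Proof.
move=> ee [/andP[_ HG] res]; split=> //.
- apply/fintype.subsetP => f fG; rewrite inE.
  by have /andP[] := forall_inP (valP G) f fG.
- by move=> f fH; have /andP[] := forall_inP (valP H) f fH.
move=> v vV; have := res v vV.
have -> : deg (Defs.induced G (vertices H)) v = degin (edges G) v (vertices H).
  apply: eq_card => u; rewrite !inE /adj /Defs.induced /edges /= inE andbC; congr (_ && _).
  by rewrite finset.subUset !finset.sub1set vV.
have -> : deg H v = degin (edges H) v finset.setT by apply: eq_card => u; rewrite !inE.
apply: le_trans; rewrite ler_wpM2r ?ler0n //; lra.
Qed.

(** Everything but the first term is a multiple of [N * n], where [N = p * n / C] is at least [1];
    the coefficient [3] absorbs [n] and the two units. *)
Lemma sparse_budget (R : realType) (e C eta p n : R) :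
    0 < e -> 0 < C -> 1 <= n -> C <= p * n ->
    (32 / e ^+ 2 + 256 / e ^+ 3 + 3) / C <= eta / 2 ->
  eta / 2 * p * n ^+ 2 + (32 * p * n ^+ 2 / (e ^+ 2 * C) + 1) + n
    + (256 * n / e ^+ 3 + 1) <= eta * p * n ^+ 2.
Proof.
move=> e0 C0 n1 Cpn; rewrite ler_pdivrMr // => bud.
have n0 : 0 <= n by lra.
have e2 : 0 < e ^+ 2 by exact: exprn_gt0.
have e3 : 0 < e ^+ 3 by exact: exprn_gt0.
set N := p * n / C.
have N1 : 1 <= N by rewrite /N ler_pdivlMr // mul1r.
have -> : 32 * p * n ^+ 2 / (e ^+ 2 * C) = 32 / e ^+ 2 * (N * n).
  by rewrite /N; field; rewrite !gt_eqF.
have -> : 256 * n / e ^+ 3 = 256 / e ^+ 3 * n by rewrite mulrAC.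
have pn : p * n ^+ 2 = N * n * C by rewrite /N; field; rewrite gt_eqF.
rewrite -[eta / 2 * p * _]mulrA -[eta * p * _]mulrA pn.
have a0 : 0 <= 32 / e ^+ 2 by apply: divr_ge0 (ler0n _ _) (ltW e2).
have b0 : 0 <= 256 / e ^+ 3 by apply: divr_ge0 (ler0n _ _) (ltW e3).
have nN : n <= N * n by rewrite ler_peMl.
have k0 : 0 <= N * n by lra.
have k1 := ler_wpM2r k0 bud; have k2 := ler_wpM2l b0 nN.
move: (32 / e ^+ 2) (256 / e ^+ 3) a0 b0 k1 k2 bud => a b a0 b0 k1 k2 bud.
lra.
Qed.

(** This follows from [x ^+ 4 / 24 <= expR x], with [72 = 3 * 24]. *)
Lemma expRN_cube_le (R : realType) (ep : R) (k : nat) :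
  0 < ep -> 1 <= k%:R :> R -> 72 / ep <= k%:R -> 3 * expR (- k%:R) <= ep * k%:R ^- 3.
Proof.
move=> ep0 k1 epk; set x : R := k%:R in k1 epk *.
have x0 : 0 < x by lra.
have x3 : 0 < x ^+ 3 by exact: exprn_gt0.
rewrite ler_pdivlMr //.
have := @expR_ge1Dxn R x 3 (ltW x0).
rewrite ler_pdivrMr // in epk.
move=> h; rewrite expRN [3 * _ * _]mulrAC ler_pdivrMr ?expR_gt0 //.
apply: (@le_trans _ _ (ep * (x ^+ 4 / 24))); last first.
  rewrite ler_pM2l //; apply: le_trans h; rewrite -[4`!]/24%N; lra.
have := ler_wpM2r (ltW x3) epk; lra.
Qed.

Local Open Scope classical_set_scope.

Theorem theorem5p2 (R : realType) (eps : R) (eps_gt0 : 0 < eps) :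
  exists delta C : R, [/\ 0 < delta, 0 < C &
    forall p : nat -> R,
      (forall n, 0 <= p n <= 1) ->
      (\forall n \near \oo, C / n%:R <= p n) ->
      (fun n : nat => 1 - Gnp_prob (p n) (fun G : graph 'I_n =>
         forall H : graph 'I_n,
           residual (1 / 2 + eps) H G ->
           eps * n%:R <= #|vertices H|%:R ->
           (exists S : graph 'I_n,
              [/\ subgraph S H, vertices S = vertices H,
                  expander2 (C / p n) S &
                  #|edges S|%:R <= delta * p n * n%:R ^+ 2]) ->
           hamiltonian H))
      =o_\oo (fun n : nat => n%:R ^- 3 : R)].
Proof.
(* The tail bounds want [e <= 1 / 4], and residuality for [eps] gives resilience for any smaller
   [e]. *)
pose e := Num.min eps (1 / 4).
have e0 : 0 < e by rewrite lt_min eps_gt0 divr_gt0.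
have ee : e <= eps by rewrite ge_min lexx.
have e04 : 0 < e <= 1 / 4 by rewrite e0 ge_min lexx orbT.
move: e e0 ee e04 => e e0 ee e04.
(* [z] makes [expR (1 - z)] at most [w / 4], and [eta] is then chosen to make [z * eta] equal to
   [w / 4]. *)
pose th := e ^+ 4 / 1024; pose w := th * (e / 8); pose z := 1 + 4 / w.
have th0 : 0 < th by apply: divr_gt0 (exprn_gt0 _ e0) _; rewrite ltr0n.
have w0 : 0 < w by apply: mulr_gt0 th0 _; apply: divr_gt0.
have w40 : 0 < 4 / w by rewrite divr_gt0.
have z0 : 0 < z by rewrite addr_gt0.
pose eta := w / 4 / z.
have eta0 : 0 < eta by apply: divr_gt0 z0; apply: divr_gt0.
have zeta : z * eta + expR (1 - z) <= w / 2.
  have -> : z * eta = w / 4 by rewrite mulrC divfK ?gt_eqF.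
  have -> : 1 - z = - (4 / w) by rewrite /z; lra.
  have : expR (- (4 / w)) <= w / 4.
    rewrite expRN -[w / 4]invrK lef_pV2 ?posrE ?expR_gt0 ?invr_gt0 ?divr_gt0 //.
    by rewrite invf_div (le_trans _ (expR_ge1Dx _)) // lerDr.
  lra.
pose ka : R := 32 / e ^+ 2 + 256 / e ^+ 3 + 3.
have ka0 : 0 < ka by rewrite !addr_gt0 ?divr_gt0 ?ltr0n ?exprn_gt0.
(* The summands serve, in order, the edge budget, the union over sparse sets, the connector and the
   edge count. *)
pose C := 2 * ka / eta + 14 / w + 4 / th + 16.
have c1 : 0 < 2 * ka / eta by apply: divr_gt0 eta0; apply: mulr_gt0.
have c2 : 0 < 14 / w by rewrite divr_gt0 ?ltr0n.
have c3 : 0 < 4 / th by rewrite divr_gt0.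
have C16 : 16 <= C by rewrite /C; lra.
have C0 : 0 < C by lra.
have Cth : 4 <= th * C by rewrite mulrC -ler_pdivrMr // /C; lra.
have Cw : 14 <= w * C by rewrite mulrC -ler_pdivrMr // /C; lra.
have Cka : ka / C <= eta / 2.
  have : 2 * ka / eta <= C by rewrite /C; lra.
  rewrite ler_pdivrMr // ler_pdivrMr //; lra.
(* Half of the budget [eta] goes to the given expander; the other half is left for the edges added
   in the proof. *)
exists (eta / 2), C; split; [by rewrite divr_gt0 | by [] |].
move=> p p01 pC; apply/eqoP => ep ep0; near=> n.
have n1 : 1 <= n%:R :> R by near: n; exact: nbhs_infty_ger.
have nn0 : 0 < n%:R :> R by apply: lt_le_trans n1.
have en : 4 <= e ^+ 2 * n%:R.
  rewrite mulrC -ler_pdivrMr ?exprn_gt0 //; near: n; exact: nbhs_infty_ger.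
have epn : 72 / ep <= n%:R by near: n; exact: nbhs_infty_ger.
have Cpn : C <= p n * n%:R by rewrite -ler_pdivrMr //; near: n.
have pn0 : 0 < p n by rewrite -(pmulr_lgt0 _ nn0); apply: lt_le_trans Cpn.
have pn1 : 0 < p n <= 1 by rewrite pn0; case/andP: (p01 n).
pose bad := @bad_edges R 'I_n (p n) e C (eta * p n * n%:R ^+ 2).
set f := (X in `|X|).
suff /andP[f0 fb] : 0 <= f <= edge_prob (p n) bad.
  rewrite ger0_norm // ger0_norm ?invr_ge0 ?exprn_ge0 //.
  apply: (le_trans fb); apply: le_trans (expRN_cube_le ep0 n1 epn).
  have := @bad_edges_prob R 'I_n (p n) e C eta z pn1 e04.
  by rewrite card_ord; apply=> //; exact: ltW.
apply: Gnp_prob_fail => // G vG nbad H res eV [S [/andP[_ SH] vS expS cS]].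
move: nbad; rewrite !negb_or card_ord => /and3P[good1 good2]; rewrite -leNgt => cG.
have [||||||s [s2 us cs sV]] := @resilient_hamiltonian R 'I_n (p n) e C
    (eta * p n * n%:R ^+ 2) (edges G) (edges H) (edges S) (vertices H)
    pn0 e04 C0 _ (residual_resilient ee res) _ _ good1 _ SH _ _;
  rewrite ?card_ord //.
- by apply: le_trans eV; rewrite ler_wpM2r // ltW.
- by rewrite -vS.
- apply: le_trans (sparse_budget e0 C0 n1 Cpn Cka).
  by rewrite !lerD2r.
by exists s.
Unshelve. all: by end_near.
Qed.
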